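(* Let $V$ be a $\frac{\mathbb Z}{2}$-graded meromorphic open-string vertex algebra, $\theta$ an involution of $V$, and $(W,Y_W^\theta,\mathbf d_W,D_W)$ a $\theta$-twisted $V$-module. Let $n\ge1$, let $v_1,\dots,v_n\in V$ be homogeneous of parities $|v_1|,\dots,|v_n|\in\{0,1\}$, let $w\in W$, $w'\in W'$, and let $$f(z_1,\dots,z_n)=\prod_{i=1}^nz_i^{|v_i|/2}\,\frac{g(z_1,\dots,z_n)}{\prod_{i=1}^nz_i^{q_i}\prod_{1\le i<j\le n}(z_i-z_j)^{q_{ij}}}$$ ($g$ a polynomial, $q_i,q_{ij}\in\mathbb N$) be the algebraic function such that for every $p\in\mathbb Z$ the product $\langle w',(Y_W^\theta)^p(v_1,z_1)\cdots(Y_W^\theta)^p(v_n,z_n)w\rangle$ converges absolutely in the region $|z_1|>\cdots>|z_n|>0$ to the $p$-th branch $f_{p,\dots,p}(z_1,\dots,z_n)=\prod_{i=1}^ne^{\frac{|v_i|}2l_p(z_i)}\frac{g(z_1,\dots,z_n)}{\prod_iz_i^{q_i}\prod_{i<j}(z_i-z_j)^{q_{ij}}}$. Then for every $p\in\mathbb Z$ the series $$\langle w',(Y_W^\theta)^p(Y_V(\cdots Y_V(Y_V(v_1,z_1-z_2)v_2,z_2-z_3)v_3\cdots,z_{n-1}-z_n)v_n,z_n)w\rangle$$ converges absolutely in the region $$\left\{(z_1,\dots,z_n)\in\mathbb C^n:\begin{aligned}&|z_n|>|z_i-z_n|>0,\ |\arg z_i-\arg z_n|<\pi/2,\ i=1,\dots,n-1;\\&|z_i-z_{i+1}|>|z_j-z_i|>0,\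 1\le j<i\le n-1\end{aligned}\right\}$$ (with $z_n\neq0$) to $f_{p,\dots,p}(z_1,\dots,z_n)$.
   Context: $\mathbb N=\{0,1,2,\dots\}$. **$\frac{\mathbb Z}{2}$-graded MOSVA.** A $\frac{\mathbb Z}{2}$-graded meromorphic open-string vertex algebra is a graded space $V=\coprod_{n\in\frac12\mathbb Z}V_{(n)}$ with a linear map $Y_V:V\otimes V\to V[[x,x^{-1}]]$ and a vacuum $\mathbf 1\in V$ such that: $V_{(n)}=0$ for $n$ sufficiently negative; with $\mathbf d_Vv=nv$ for $v\in V_{(n)}$, $[\mathbf d_V,Y_V(u,x)]=Y_V(\mathbf d_Vu,x)+x\frac{d}{dx}Y_V(u,x)$; $Y_V(\mathbf 1,x)=1_V$; $Y_V(u,x)\mathbf 1\in V[[x]]$ with constant term $u$; with $D_Vu=\lim_{x\to0}\frac{d}{dx}Y_V(u,x)\mathbf 1$, $\frac{d}{dx}Y_V(u,x)=Y_V(D_Vu,x)=[D_V,Y_V(u,x)]$; and for all $u_1,v\in V$ there is $P\in\mathbb N$ such that for all $u_2\in V$, $(x_0+x_2)^PY_V(u_1,x_0+x_2)Y_V(u_2,x_2)v=(x_0+x_2)^PY_V(Y_V(u_1,x_0)u_2,x_2)v$. For homogeneous $v$, the parity $|v|$ is $1$ if $v\in\coprod_{n\in\mathbb Z+1/2}V_{(n)}$ and $0$ if $v\in\coprod_{n\in\mathbb Z}V_{(n)}$. **Twisted modules.** An involution $\theta$ of $V$ is a grading-preserving linear isomorphism with $\theta^2=1_V$ and $\theta(Y_V(u,x)v)=Y_V(\theta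 u,x)\theta v$. A $\theta$-twisted $V$-module is a $\mathbb C$-graded space $W=\coprod_{n\in\mathbb C}W_{(n)}$ with a linear map $Y_W^\theta:V\otimes W\to W[[x^{1/2},x^{-1/2}]]$, $v\otimes w\mapsto Y_W^\theta(v,x)w=\sum_{n\in\frac12\mathbb Z}v_nw\,x^{-n-1}$, an operator $\mathbf d_W$ of weight $0$ and an operator $D_W$ of weight $1$ (no axiom is imposed on $D_W$), such that: (1) $W_{(m)}=0$ when $\mathrm{Re}(m)$ is sufficiently negative; $\mathbf d_Ww=mw$ for $w\in W_{(m)}$; $[\mathbf d_W,Y_W^\theta(u,x)]=Y_W^\theta(\mathbf d_Vu,x)+x\frac{d}{dx}Y_W^\theta(u,x)$; (2) $Y_W^\theta(\mathbf 1,x)=1_W$; (3) $\frac{d}{dx}Y_W^\theta(u,x)=Y_W^\theta(D_Vu,x)$; (4) for every homogeneous $v_1\in V$ and $w\in W$ there is $P\in\mathbb N$ such that for every homogeneous $v_2\in V$, $$(x_0+x_2)^{P+|v_1|/2}x_2^{|v_2|/2}Y_W^\theta(v_1,x_0+x_2)Y_W^\theta(v_2,x_2)w=(x_0+x_2)^{P+|v_1|/2}x_2^{|v_2|/2}Y_W^\theta(Y_V(v_1,x_0)v_2,x_2)w$$ as series in $W((x_0,x_2))$ (on the left, powers of $x_0+x_2$ are expanded in nonnegative powers of $x_2$; on the right, in nonnegative powers of $x_0$). **Branches.** For $z\in\mathbb C^\times$ and $p\in\mathbb Z$, $l_p(z)=\log|z|+i(\arg z+2\pi p)$ with $\arg z\in[0,2\pi)$.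 $W'=\coprod_{n\in\mathbb C}W_{(n)}^*$ is the restricted dual. The $p$-th branch of $Y_W^\theta$ is $(Y_W^\theta)^p(v,z)=\sum_{n\in\frac12\mathbb Z}v_n\,e^{(-n-1)l_p(z)}$. Products and iterates are understood as the multiple series obtained by expanding each vertex operator into its components. It is known that a function $f$ as in the claim (describing the product) exists.
   Formalization: Absolute convergence of the iterate is taken in the iterated sense (mode of Y_W^θ summed last, each one-index series absolutely convergent); as an unordered multiple series the claim fails for n=3, e.g. Heisenberg, f=z_1^{-2}, at (1.1,1.9,1). *)

(* Defs.v *)
From HB Require Import structures.
From mathcomp Require Import all_boot all_order all_algebra.
From mathcomp Require Import finmap complex.
From mathcomp Require Import all_classical all_reals all_analysis.
(* mpoly is not imported: its notations clash with those of the analysis library *)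
From mathcomp Require mpoly.

Set Implicit Arguments.
Unset Strict Implicit.
Unset Printing Implicit Defensive.
Import Order.TTheory GRing.Theory Num.Theory.
Import numFieldNormedType.Exports.

Local Open Scope classical_set_scope.
Local Open Scope fset_scope.
Local Open Scope ring_scope.

(* Half-integers are encoded by their doubles: [m : int] stands for m / 2. *)

Definition half (R : realType) (m : int) : R[i] := m%:~R / 2%:R.

Definition par (m : int) : nat := odd `|m|%N.

Definition cabs (R : realType) (z : R[i]) : R := complex.Re `|z|.

Definition cexp (R : realType) (z : R[i]) : R[i] :=
  (expR (complex.Re z))%:C%C * (cos (complex.Im z) +i* sin (complex.Im z))%C.

(* The argument in [0, 2 pi[; meaningful only for z != 0. *)
Definition carg (R : realType) (z : R[i]) : R :=
  get [set t : R | [/\ 0 <= t, t < 2 * pi &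
    z = (cabs z)%:C%C * (cos t +i* sin t)%C]].

Definition clog (R : realType) (p : int) (z : R[i]) : R[i] :=
  (ln (cabs z) +i* (carg z + 2 * pi * p%:~R))%C.

Definition gbinom (F : fieldType) (a : F) (k : nat) : F :=
  (\prod_(i < k) (a - i%:R)) / (k`!)%:R.

(* Absolute convergence of an unordered series; the sum is the limit of the *)
(* finite partial sums along the directed set of finite subsets of I.       *)
Definition abs_sums_to (R : realType) (I : choiceType) (a : I -> R[i])
    (s : R[i]) : Prop :=
  summable [set: I] (fun i => (cabs (a i))%:E) /\
  forall e : R, 0 < e -> exists F0 : {fset I}, forall F : {fset I},
    F0 `<=` F -> cabs (\sum_(i <- enum_fset F) a i - s) < e.

(* Iterated absolute convergence of a multiple series indexed by Z^d: the   *)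
(* summation over the last index is the outermost one, and at each stage    *)
(* the series over one index converges absolutely to the term of the next.  *)
(* Iterates of vertex operators are summed in this sense: each mode of the  *)
(* outer operator is applied to the sum of the inner iterate.  Unordered    *)
(* absolute convergence of the whole multiple series fails on the region    *)
(* below: the expansion of (z_3 + x_2 + x_1)^(-2) in powers of              *)
(* x_1 = z_1 - z_2 and x_2 = z_2 - z_3 needs |x_1| + |x_2| < |z_3|, whereas *)
(* summing first over the terms of fixed degree in (x_1, x_2) only needs    *)
(* |x_1 + x_2| = |z_1 - z_3| < |z_3|.                                       *)
Definition ext_index (d : nat) (N : {ffun 'I_d -> int}) (m : int) :
    {ffun 'I_d.+1 -> int} :=
  [ffun i => if unlift ord_max i is Some j then N j else m].

Fixpoint iter_abs_sums_to (R : realType) (d : nat) :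
    ({ffun 'I_d -> int} -> R[i]) -> R[i] -> Prop :=
  match d with
  | 0 => fun a s => a [ffun=> 0] = s
  | d'.+1 => fun a s => exists b : int -> R[i],
      (forall m, iter_abs_sums_to (fun N => a (ext_index N m)) (b m)) /\
      abs_sums_to b s
  end.

(* G i is the homogeneous subspace of index i and V is the internal direct  *)
(* sum of the G i.                                                          *)
Definition is_grading (K : fieldType) (V : lmodType K) (I : choiceType)
    (G : I -> set V) : Prop :=
  [/\ forall i, G i 0,
      forall i a u v, G i u -> G i v -> G i (a *: u + v),
      forall v, exists (s : seq I) (u : I -> V),
        (forall i, G i (u i)) /\ v = \sum_(i <- s) u i &
      forall (s : seq I) (u : I -> V), uniq s -> (forall i, G i (u i)) ->
        \sum_(i <- s) u i = 0 -> forall i, i \in s -> u i = 0].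

(* A Z/2-graded MOSVA.  [mosva_gr V k] is V_(k/2), and [mosva_Y V u m] is   *)
(* the mode u_m in Y_V(u, x) = \sum_(m in Z) u_m x^(-m-1); identities       *)
(* between formal series are written coefficientwise.                       *)
(*                                                                          *)
(* In weak associativity both sides are compared at x_0^a x_2^b.  On the    *)
(* left, (x_0 + x_2)^(P-m-1) (u_1)_m (u_2)_l v x_2^(-l-1) is expanded in    *)
(* nonnegative powers x_2^j of x_2, so m = P-1-j-a, l = j-1-b and           *)
(* P-m-1 = a+j; on the right (x_0 + x_2)^P is expanded in powers x_0^j.     *)
(* By lower truncation both sums over j have finite support.                *)
Record mosva (R : realType) := Mosva {
  mosva_car :> lmodType R[i];
  mosva_gr : int -> set mosva_car;
  mosva_Y : mosva_car -> int -> {linear mosva_car -> mosva_car};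
  mosva_one : mosva_car;
  mosva_d : {linear mosva_car -> mosva_car};
  mosva_D : mosva_car -> mosva_car := fun u => mosva_Y u (-2) mosva_one;
  mosva_grading : is_grading mosva_gr;
  mosva_Y_linear : forall m v, linear (fun u => mosva_Y u m v);
  mosva_lower : exists N : int, forall k, k < N ->
    forall v, mosva_gr k v -> v = 0;
  mosva_dE : forall k v, mosva_gr k v -> mosva_d v = half R k *: v;
  mosva_d_comm : forall u m v,
    mosva_d (mosva_Y u m v) - mosva_Y u m (mosva_d v) =
    mosva_Y (mosva_d u) m v + (- m - 1)%:~R *: mosva_Y u m v;
  mosva_one_l : forall m v,
    mosva_Y mosva_one m v = if m == -1 then v else 0;
  mosva_creation : forall u m, 0 <= m -> mosva_Y u m mosva_one = 0;
  mosva_creation_cst : forall u, mosva_Y u (-1) mosva_one = u;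
  mosva_D_deriv : forall u m v,
    mosva_Y (mosva_D u) m v = (- m)%:~R *: mosva_Y u (m - 1) v;
  mosva_D_comm : forall u m v,
    mosva_D (mosva_Y u m v) - mosva_Y u m (mosva_D v) =
    (- m)%:~R *: mosva_Y u (m - 1) v;
  mosva_assoc : forall u1 v, exists P : nat, forall u2 (a b : int),
    \sum_(j \in [set: nat]) gbinom ((a + j%:Z)%:~R : R[i]) j *:
       mosva_Y u1 (P%:Z - 1 - j%:Z - a) (mosva_Y u2 (j%:Z - 1 - b) v) =
    \sum_(j \in [set: nat]) gbinom (P%:R : R[i]) j *:
       mosva_Y (mosva_Y u1 (j%:Z - 1 - a) u2) (P%:Z - 1 - j%:Z - b) v
}.

Record involution (R : realType) (V : mosva R) := Involution {
  inv_fun :> {linear V -> V};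
  inv_gr : forall k v, mosva_gr k v -> mosva_gr k (inv_fun v);
  inv_invol : involutive inv_fun;
  inv_Y : forall u m v,
    inv_fun (mosva_Y u m v) = mosva_Y (inv_fun u) m (inv_fun v)
}.

(* The two sides of weak associativity for modes Y(v, m) = v_(m/2) on W, as *)
(* functions of the doubled exponents (A, B): the coefficients of           *)
(* x_0^(A/2) x_2^(B/2), where k1 and k2 are the doubled weights of v1, v2.  *)
Section TwistedAssoc.
Variables (R : realType) (V : mosva R) (W : lmodType R[i]).
Variable Y : V -> int -> {linear W -> W}.

Definition tw_assoc_lhs (P : nat) (k1 : int) (v1 : V) (k2 : int) (v2 : V)
    (w : W) (A B : int) : W :=
  \sum_(j \in [set: nat]) gbinom (half R A + j%:R) j *:
    Y v1 (2 * P%:Z + (par k1)%:Z - 2 - 2 * j%:Z - A)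
      (Y v2 (2 * j%:Z + (par k2)%:Z - 2 - B) w).

(* Only integral powers of x_0 occur; A = 2 a below. *)
Definition tw_assoc_rhs (P : nat) (k1 : int) (v1 : V) (k2 : int) (v2 : V)
    (w : W) (A B : int) : W :=
  if odd `|A|%N then 0 else
  let a := (A %/ 2)%Z in
  \sum_(j \in [set: nat]) gbinom (P%:R + half R (par k1)) j *:
    Y (mosva_Y v1 (j%:Z - 1 - a) v2)
      (2 * P%:Z + (par k1)%:Z + (par k2)%:Z - 2 - 2 * j%:Z - B) w.

(* The series with these coefficients lies in W((x_0, x_2)). *)
Definition in_laurent2 (c : int -> int -> W) : Prop :=
  exists N : int, forall A B, c A B != 0 ->
    [/\ ~~ odd `|A|%N, ~~ odd `|B|%N, N <= A & N <= B].

End TwistedAssoc.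

(* [tw_Y W u m] is the mode u_(m/2) in                                      *)
(* Y_W(u, x) = \sum_(m in Z) u_(m/2) x^(-m/2-1).                            *)
(* The axioms of a theta-twisted module do not involve theta: the           *)
(* half-integrality of the modes is governed by parity, not by theta.       *)
Record twisted_module (R : realType) (V : mosva R) (theta : involution V) :=
  TwistedModule {
  tw_car :> lmodType R[i];
  tw_gr : R[i] -> set tw_car;
  tw_Y : V -> int -> {linear tw_car -> tw_car};
  tw_d : {linear tw_car -> tw_car};
  tw_D : {linear tw_car -> tw_car};
  tw_grading : is_grading tw_gr;
  tw_Y_linear : forall m w, linear (fun u => tw_Y u m w);
  tw_d_gr : forall m w, tw_gr m w -> tw_gr m (tw_d w);
  tw_D_gr : forall m w, tw_gr m w -> tw_gr (m + 1) (tw_D w);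
  tw_lower : exists N : R, forall m, complex.Re m < N ->
    forall w, tw_gr m w -> w = 0;
  tw_dE : forall m w, tw_gr m w -> tw_d w = m *: w;
  tw_d_comm : forall u m w,
    tw_d (tw_Y u m w) - tw_Y u m (tw_d w) =
    tw_Y (mosva_d V u) m w + half R (- m - 2) *: tw_Y u m w;
  tw_one : forall m w,
    tw_Y (mosva_one V) m w = if m == -2 then w else 0;
  tw_deriv : forall u m w,
    tw_Y (mosva_D u) m w = half R (- m) *: tw_Y u (m - 2) w;
  tw_assoc : forall k1 v1 w, mosva_gr k1 v1 ->
    exists P : nat, forall k2 v2, mosva_gr k2 v2 ->
      [/\ in_laurent2 (tw_assoc_lhs tw_Y P k1 v1 k2 v2 w),
          in_laurent2 (tw_assoc_rhs tw_Y P k1 v1 k2 v2 w) &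
          forall A B, tw_assoc_lhs tw_Y P k1 v1 k2 v2 w A B =
                      tw_assoc_rhs tw_Y P k1 v1 k2 v2 w A B]
}.

(* \coprod_n W_(n)^* as the functionals on W that vanish on all but         *)
(* finitely many W_(n).                                                     *)
Record restricted_dual (R : realType) (V : mosva R) (theta : involution V)
    (W : twisted_module theta) := RestrictedDual {
  rdual_fun :> {linear W -> R[i]^o};
  rdual_finite : exists s : seq R[i], forall m, m \notin s ->
    forall w, tw_gr m w -> rdual_fun w = 0
}.

Section Correlation.
Variables (R : realType) (V : mosva R) (theta : involution V).
Variables (W : twisted_module theta) (n : nat).
Variables (v : 'I_n.+1 -> V) (w : W) (w' : restricted_dual W).
Implicit Types (p : int) (z : 'I_n.+1 -> R[i]) (N : {ffun 'I_n.+1 -> int}).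

(* For i : 'I_n, the points z_i and z_(i+1), indices starting from 0. *)
Definition zlo z (i : 'I_n) : R[i] := z (widen_ord (leqnSn n) i).
Definition zhi z (i : 'I_n) : R[i] := z (lift ord0 i).

(* The N-th term of <w', Y_W^p(v_0, z_0) ... Y_W^p(v_n, z_n) w>, with       *)
(* N i / 2 the mode of the i-th vertex operator.                            *)
Definition product_term p z N : R[i] :=
  w' (foldr (fun i u => tw_Y W (v i) (N i) u) w (enum 'I_n.+1)) *
  \prod_(i < n.+1) cexp (half R (- N i - 2) * clog p (z i)).

(* Y_V( ... Y_V(Y_V(v_0, .) v_1, .) ... , .) v_n with mode N i in the i-th  *)
(* vertex operator, i < n.                                                  *)
Definition iterate_vec N : V :=
  foldl (fun u (i : 'I_n) =>
           mosva_Y u (N (widen_ord (leqnSn n) i)) (v (lift ord0 i)))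
    (v ord0) (enum 'I_n).

(* N ord_max / 2 is the mode of Y_W, the outermost vertex operator. *)
Definition iterate_term p z N : R[i] :=
  w' (tw_Y W (iterate_vec N) (N ord_max) w) *
  (\prod_(i < n)
     (zlo z i - zhi z i) ^ (- N (widen_ord (leqnSn n) i) - 1)) *
  cexp (half R (- N ord_max - 2) * clog p (z ord_max)).

End Correlation.

Section Regions.
Variables (R : realType) (n : nat).
Implicit Types (z : 'I_n.+1 -> R[i]).

Definition product_region z : Prop :=
  (forall i j : 'I_n.+1, (i < j)%N -> cabs (z j) < cabs (z i)) /\
  (forall i, 0 < cabs (z i)).

Definition iterate_region z : Prop :=
  [/\ z ord_max != 0,
      forall i : 'I_n,
        [/\ cabs (zlo z i - z ord_max) < cabs (z ord_max),
            0 < cabs (zlo z i - z ord_max) &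
            `|carg (zlo z i) - carg (z ord_max)| < pi / 2] &
      forall j i : 'I_n, (j < i)%N ->
        cabs (zlo z j - zlo z i) < cabs (zlo z i - zhi z i) /\
        0 < cabs (zlo z j - zlo z i)].

(* k i is the doubled weight of v_i, so that par (k i) is its parity. *)
Definition branch (k : 'I_n.+1 -> int) (g : mpoly.mpoly n.+1 R[i])
    (q : 'I_n.+1 -> nat) (qq : 'I_n.+1 -> 'I_n.+1 -> nat) (p : int) z : R[i] :=
  (\prod_(i < n.+1) cexp (half R (par (k i)) * clog p (z i))) *
  (mpoly.meval z g /
   ((\prod_(i < n.+1) z i ^+ q i) *
    (\prod_(i < n.+1) \prod_(j < n.+1 | (i < j)%N) (z i - z j) ^+ qq i j))).

End Regions.

(* Main.v *)
(** Weak associativity is applied to the product of [v_0, ..., v_n] acting on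
    [w] once for each [i < n], with the exponent [P] depending only on [v_i] and
    [w]: it moves [v_i] inside the last vertex operator, replacing [z_i] by
    [u_i + z_n].  Expanding the two sides in nonnegative powers of [z_n] and of
    [u_i] respectively is compatible with multiplication by the factors
    [z_a - z_b], so an identity "product of the [z_a - z_b] times the product
    series is a Laurent polynomial" becomes the same kind of identity for each
    coefficient in [z_n] of [Y_W(Y_V(v_0, u_0) ... Y_V(v_(n-1), u_(n-1)) v_n, z_n) w].
    That coefficient is a functional applied to a product of [n] operators on
    [V], and one concludes by induction on [n].  At each level the sum over the
    powers of [z_n] is a Cauchy product of the binomial series of
    [(1 + u_i / z_n)^a], where [|u_i| < |z_n|]; for half-integral [a] the
    condition on the arguments selects the branch.  The initial identity comes
    from the uniqueness of absolutely convergent Laurent expansions, once the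
    half-integral exponents are removed by parity. *)

Require Import Defs.
From HB Require Import structures.
From mathcomp Require Import all_boot all_order all_algebra.
From mathcomp Require Import finmap complex.
From mathcomp Require Import all_classical all_reals all_analysis.
From mathcomp Require mpoly.
From mathcomp Require Import cyclic separable cyclotomic.
From mathcomp Require Import zify ring lra.

Set Implicit Arguments.
Unset Strict Implicit.
Unset Printing Implicit Defensive.
Import Order.TTheory GRing.Theory Num.Theory.
Local Open Scope ring_scope.

(** * Unordered sums *)

Section ComplexModulus.
Variable R : realType.
Implicit Types x y : R[i].

(** While some operators are inside the last one and others still outside, nothing is known about
    convergence. All intermediate identities are therefore between coefficient families, where every
    expansion is a finite sum in each coefficient; analysis enters only at the two ends. Weak
    associativity compares two stages only after multiplication by [(u_i + z_n)^(P + |v_i|/2)]. This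
    factor can be cancelled because lower truncation in [V] bounds the powers of [u_i] from below,
    so that a lowest power exists. The induction closes because a factor [z_a - z_n] turns into
    [u_a], a mere shift of exponents, while [z_a - z_b = u_a - u_b] keeps its form, and the
    inequalities between the [|z_j - z_i|] are invariant under translation. The functional at the
    next level is not an element of [W'] but a functional composed with a mode, so the inductive
    statement allows any linear functional and assumes a formal identity instead of convergence of a
    product. Recorded exponents are integers throughout: the half powers are constants [hh], and
    [z_n] collects those of the operators moved inside. *)

Lemma cabsE x : (cabs x)%:C%C = `|x|.
Proof. by rewrite /cabs normc_def. Qed.

Lemma cabs_ge0 x : 0 <= cabs x.
Proof. by rewrite -ler0c cabsE. Qed.

Lemma cabsM x y : cabs (x * y) = cabs x * cabs y.
Proof. by apply: complexI; rewrite rmorphM /= !cabsE normrM. Qed.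

Lemma cabs0 : cabs (0 : R[i]) = 0.
Proof. by apply: complexI; rewrite cabsE normr0. Qed.

Lemma cabs1 : cabs (1 : R[i]) = 1.
Proof. by apply: complexI; rewrite cabsE normr1. Qed.

Lemma cabsD x y : cabs (x + y) <= cabs x + cabs y.
Proof. by rewrite -lecR rmorphD /= !cabsE ler_normD. Qed.

Lemma cabsN x : cabs (- x) = cabs x.
Proof. by apply: complexI; rewrite !cabsE normrN. Qed.

Lemma cabsB x y : cabs (x - y) = cabs (y - x).
Proof. by rewrite -cabsN opprB. Qed.

Lemma cabs_eq0 x : (cabs x == 0) = (x == 0).
Proof. by rewrite -(inj_eq (@complexI R)) cabsE normr_eq0. Qed.

Lemma cabs_gt0 x : (0 < cabs x) = (x != 0).
Proof. by rewrite lt0r cabs_ge0 andbT cabs_eq0. Qed.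

Lemma cabsX x n : cabs (x ^+ n) = cabs x ^+ n.
Proof. by elim: n => [|n IH]; rewrite ?expr0 ?cabs1 // !exprS cabsM IH. Qed.

Lemma cabsV x : cabs x^-1 = (cabs x)^-1.
Proof. by apply: complexI; rewrite fmorphV /= !cabsE normfV. Qed.

Lemma cabsXz x (m : int) : cabs (x ^ m) = cabs x ^ m.
Proof. by case: m => m; rewrite ?NegzE -?exprnP ?cabsX // -!exprnN cabsV cabsX. Qed.

Lemma cabs_nat n : cabs (n%:R : R[i]) = n%:R.
Proof. by apply: complexI; rewrite cabsE normr_nat rmorph_nat. Qed.

Lemma cabs_real (r : R) : cabs r%:C%C = `|r|.
Proof. by rewrite /cabs normc_def /= expr0n addr0 sqrtr_sqr. Qed.

Lemma cabs_sum (I : Type) (s : seq I) (P : pred I) (F : I -> R[i]) :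
  cabs (\sum_(i <- s | P i) F i) <= \sum_(i <- s | P i) cabs (F i).
Proof.
elim/big_rec2: _ => [|i u v _ h]; first by rewrite cabs0.
by apply: le_trans (cabsD _ _) _; rewrite lerD2l.
Qed.

Lemma Re_le_cabs x : `|complex.Re x| <= cabs x.
Proof.
rewrite /cabs normc_def /= -sqrtr_sqr ler_wsqrtr //.
by rewrite lerDl sqr_ge0.
Qed.

Lemma Im_le_cabs x : `|complex.Im x| <= cabs x.
Proof.
rewrite /cabs normc_def /= -sqrtr_sqr ler_wsqrtr //.
by rewrite lerDr sqr_ge0.
Qed.

End ComplexModulus.

Section UnorderedSums.
Variable R : realType.
Local Notation C := R[i].

(* [abs_sums_to] with finite subsets presented by duplicate-free sequences. *)
Definition asum (I : eqType) (a : I -> C) (s : C) : Prop :=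
  (exists M : R, forall t, uniq t -> \sum_(i <- t) cabs (a i) <= M) /\
  (forall e : R, 0 < e -> exists t0 : seq I, forall t, uniq t ->
     {subset t0 <= t} -> cabs (\sum_(i <- t) a i - s) < e).

Lemma abs_sums_toP (I : choiceType) (a : I -> C) s :
  abs_sums_to a s <-> asum a s.
Proof.
have fs (t : seq I) : uniq t -> perm_eq (enum_fset [fset x in t]%fset) t.
  by move=> ut; apply: uniq_perm => // x; rewrite inE.
split=> -[H1 H2]; split.
- move: H1; rewrite /summable => H1.
  pose S := (\esum_(x in [set: I]) `|(cabs (a x))%:E|)%E.
  exists (fine S) => t ut.
  have Sf : S \is a fin_num.
    by rewrite ge0_fin_numE //; apply: esum_ge0 => i _; rewrite abse_ge0.
  rewrite -lee_fin fineK //.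
  rewrite /S esum_ge //; exists [set` t]%classic.
    by split => //; exact: finite_seq.
  rewrite -(@fsbig_seq _ _ _ _ _ _ ut) /= -sumEFin.
  by apply: lee_sum => i _; rewrite lee_fin ler_norm.
- move=> e e0; have [F0 HF] := H2 _ e0; exists (enum_fset F0) => t ut sub.
  rewrite -(perm_big _ (fs _ ut)); apply: HF.
  by apply/fsubsetP => x xF; rewrite inE; apply: sub.
- have [M HM] := H1; rewrite /summable.
  apply: (@le_lt_trans _ _ M%:E); last by rewrite ltry.
  rewrite /esum; apply: ge_ereal_sup => _ [A [fA _] <-].
  rewrite fsbig_finite //= -[X in (_ <= X)%E]/(M%:E).
  rewrite (eq_bigr (fun i => (cabs (a i))%:E)); last first.
    by move=> i _; rewrite ger0_norm ?cabs_ge0.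
  by rewrite sumEFin lee_fin; apply: HM; exact: finmap.fset_uniq.
- move=> e e0; have [t0 Ht] := H2 _ e0; exists [fset x in t0]%fset => F sub.
  apply: Ht; first exact: finmap.fset_uniq.
  by move=> x xt; apply: (fsubsetP sub); rewrite inE.
Qed.

Lemma eq_asum (I : eqType) (a b : I -> C) s : a =1 b -> asum a s -> asum b s.
Proof. by move=> /funext ->. Qed.

Lemma asumZ (I : eqType) (a : I -> C) s k : asum a s -> asum (fun i => k * a i) (k * s).
Proof.
move=> [[M HM] H]; split.
  exists (cabs k * M) => t ut.
  rewrite (eq_bigr (fun i => cabs k * cabs (a i))) => [|i _]; last exact: cabsM.
  by rewrite -mulr_sumr ler_wpM2l ?cabs_ge0 // HM.
move=> e e0; have k1 : 0 < cabs k + 1 by rewrite ltr_wpDl ?cabs_ge0.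
have [t0 Ht] := H (e / (cabs k + 1)) (divr_gt0 e0 k1).
exists t0 => t ut sub; rewrite -mulr_sumr -mulrBr cabsM.
have h := Ht t ut sub.
apply: (@le_lt_trans _ _ (cabs k * (e / (cabs k + 1)))).
  by rewrite ler_wpM2l ?cabs_ge0 // ltW.
rewrite mulrCA gtr_pMr // ltr_pdivrMr // mul1r; lra.
Qed.

Lemma asumD (I : eqType) (a b : I -> C) s r :
  asum a s -> asum b r -> asum (fun i => a i + b i) (s + r).
Proof.
move=> [[M HM] H] [[N HN] K]; split.
  exists (M + N) => t ut; apply: le_trans (lerD (HM t ut) (HN t ut)).
  by rewrite -big_split /=; apply: ler_sum => i _; exact: cabsD.
move=> e e0; have e2 : 0 < e / 2 by rewrite divr_gt0.
have [t1 H1] := H _ e2; have [t2 H2] := K _ e2.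
exists (t1 ++ t2) => t ut sub.
have h1 : cabs (\sum_(i <- t) a i - s) < e / 2.
  by apply: H1 => // x h; apply: sub; rewrite mem_cat h.
have h2 : cabs (\sum_(i <- t) b i - r) < e / 2.
  by apply: H2 => // x h; apply: sub; rewrite mem_cat h orbT.
rewrite big_split /=.
have -> : \sum_(i <- t) a i + \sum_(i <- t) b i - (s + r) =
  (\sum_(i <- t) a i - s) + (\sum_(i <- t) b i - r) by ring.
by apply: le_lt_trans (cabsD _ _) _; rewrite (splitr e) ltrD.
Qed.

Lemma asum0 (I : eqType) : asum (fun _ : I => 0) 0.
Proof.
split; first by exists 0 => t _; rewrite big1 // => i _; rewrite cabs0.
by move=> e e0; exists [::] => t _ _; rewrite big1 // subrr cabs0.
Qed.

Lemma asumB (I : eqType) (a b : I -> C) s r :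
  asum a s -> asum b r -> asum (fun i => a i - b i) (s - r).
Proof.
move=> Ha /(asumZ (-1)) Hb.
by have := asumD Ha Hb; rewrite mulN1r; apply: eq_asum => i; rewrite mulN1r.
Qed.

Lemma asum_sum (I : eqType) (J : Type) (r : seq J) (a : J -> I -> C) s :
  (forall j, asum (a j) (s j)) ->
  asum (fun i => \sum_(j <- r) a j i) (\sum_(j <- r) s j).
Proof.
move=> H; elim: r => [|j r IH].
  by rewrite big_nil; apply: eq_asum (asum0 _) => i; rewrite big_nil.
rewrite big_cons; apply: eq_asum (asumD (H j) IH) => i.
by rewrite big_cons.
Qed.

Lemma asum_unique (I : eqType) (a : I -> C) s r : asum a s -> asum a r -> s = r.
Proof.
move=> [_ H] [_ K]; apply/eqP; rewrite -subr_eq0 -cabs_eq0; apply/eqP.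
apply/eqP; rewrite eq_le cabs_ge0 andbT leNgt; apply/negP => h.
have e2 : 0 < cabs (s - r) / 2 by rewrite divr_gt0.
have [t1 H1] := H _ e2; have [t2 H2] := K _ e2.
pose t := undup (t1 ++ t2).
have h1 : cabs (\sum_(i <- t) a i - s) < cabs (s - r) / 2.
  by apply: H1 => [|x xt]; rewrite ?undup_uniq // mem_undup mem_cat xt.
have h2 : cabs (\sum_(i <- t) a i - r) < cabs (s - r) / 2.
  by apply: H2 => [|x xt]; rewrite ?undup_uniq // mem_undup mem_cat xt orbT.
have := cabsD (\sum_(i <- t) a i - r) (- (\sum_(i <- t) a i - s)).
have -> : \sum_(i <- t) a i - r + - (\sum_(i <- t) a i - s) = s - r by ring.
rewrite cabsN => h3; lra.
Qed.

Lemma asum_fin (I : eqType) (t0 : seq I) (a : I -> C) : uniq t0 ->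
  (forall i, i \notin t0 -> a i = 0) -> asum a (\sum_(i <- t0) a i).
Proof.
move=> u0 H0.
have red (V : zmodType) (F : I -> V) t : uniq t -> (forall i, i \notin t0 -> F i = 0) ->
    \sum_(i <- t) F i = \sum_(i <- [seq i <- t0 | i \in t]) F i.
  move=> ut HF.
  rewrite (bigID (mem t0)) /= [X in _ + X]big1 ?addr0; last by move=> i; apply: HF.
  rewrite -big_filter; apply: perm_big; apply: uniq_perm; rewrite ?filter_uniq //.
  by move=> i; rewrite !mem_filter andbC.
split.
  exists (\sum_(i <- t0) cabs (a i)) => t ut; rewrite red //; last first.
    by move=> i /H0 ->; rewrite cabs0.
  rewrite big_filter [leRHS](bigID (mem t)) /= lerDl.
  by apply: sumr_ge0 => i _; exact: cabs_ge0.
move=> e e0; exists t0 => t ut sub; rewrite red //.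
rewrite (_ : [seq i <- t0 | i \in t] = t0) ?subrr ?cabs0 //.
by apply/all_filterP/allP => i /sub.
Qed.

(** The condition [f (g j) != j] says that [j] lies outside the image of the injection [f]. In this
    form a change of variables also discards modes of the wrong parity and negative degrees. *)
Lemma asum_reindex (I J : eqType) (f : I -> J) (g : J -> I) (a : J -> C) s :
  cancel f g -> (forall j, f (g j) != j -> a j = 0) ->
  asum (a \o f) s <-> asum a s.
Proof.
move=> fK a0.
have red (t : seq J) (V : zmodType) (F : J -> V) :
    (forall j, f (g j) != j -> F j = 0) ->
    \sum_(j <- t) F j = \sum_(i <- map g [seq j <- t | f (g j) == j]) F (f i).
  move=> F0; rewrite big_map big_filter (bigID (fun j => f (g j) == j)) /=.
  rewrite [X in _ + X]big1 ?addr0; last by move=> j; exact: F0.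
  by apply: eq_bigr => j /eqP ->.
have ug (t : seq J) : uniq t -> uniq (map g [seq j <- t | f (g j) == j]).
  move=> ut; rewrite map_inj_in_uniq ?filter_uniq // => x y.
  rewrite !mem_filter => /andP[/eqP hx _] /andP[/eqP hy _] e.
  by rewrite -hx -hy e.
have uf (t : seq I) : uniq t -> uniq (map f t).
  by move=> ut; rewrite map_inj_uniq //; exact: can_inj fK.
split=> -[[M HM] H]; split.
- exists M => t ut; rewrite red ?HM ?ug // => j /a0 ->.
  by rewrite cabs0.
- move=> e e0; have [t0 Ht] := H _ e0; exists (map f t0) => t ut sub.
  rewrite red //; apply: Ht; first exact: ug.
  move=> i it; apply/mapP; exists (f i); rewrite ?fK // mem_filter fK eqxx /=.
  by apply: sub; rewrite map_f.
- by exists M => t ut; have := HM _ (uf _ ut); rewrite big_map.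
- move=> e e0; have [t0 Ht] := H _ e0.
  exists (map g [seq j <- t0 | f (g j) == j]) => t ut sub.
  (* The points of [t0] outside the image contribute 0; adding them makes [t'] contain [t0]. *)
  pose t' := map f t ++ [seq j <- undup t0 | f (g j) != j].
  have -> : \sum_(i <- t) (a \o f) i = \sum_(j <- t') a j.
    rewrite big_cat big_map big_filter /= [X in _ + X]big1 ?addr0 //.
  apply: Ht.
    rewrite cat_uniq uf // filter_uniq ?undup_uniq // andbT.
    apply/hasPn => j; rewrite mem_filter => /andP[hj _]; apply/negP => /mapP[i _ ji].
    by rewrite ji fK eqxx in hj.
  move=> j jt; rewrite mem_cat mem_filter mem_undup jt andbT.
  case: eqP => [e'|]; rewrite ?orbT // orbF -e'; apply: map_f; apply: sub.
  by apply: map_f; rewrite mem_filter e' eqxx.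
Qed.

End UnorderedSums.

Section SumExistence.
Variable R : realType.
Local Notation C := R[i].

Lemma ler_sum_subset (I : eqType) (F : I -> R) (t0 t : seq I) :
  uniq t0 -> uniq t -> {subset t0 <= t} -> (forall i, 0 <= F i) ->
  \sum_(i <- t0) F i <= \sum_(i <- t) F i.
Proof.
move=> u0 ut sub F0; rewrite [leRHS](bigID (mem t0)) /=.
rewrite -[X in _ <= X + _]big_filter (perm_big [seq i <- t | i \in t0]) /=.
  by rewrite lerDl sumr_ge0.
apply: uniq_perm; rewrite ?filter_uniq // => i; rewrite mem_filter /=.
by case: (boolP (i \in t0)) => //= /sub ->.
Qed.

Lemma asum_real_exists (I : eqType) (b : I -> R) (M : R) : (forall i, 0 <= b i) ->
  (forall t, uniq t -> \sum_(i <- t) b i <= M) ->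
  exists s, asum (fun i => (b i)%:C%C : C) s.
Proof.
move=> b0 bM.
pose E : set R := [set x | exists t, uniq t /\ x = \sum_(i <- t) b i]%classic.
have ubE : has_ubound E by exists M => x [t [ut ->]]; exact: bM.
have supE : has_sup E by split => //; exists 0, [::]; rewrite big_nil.
exists (sup E)%:C%C; split.
  exists M => t ut; rewrite (eq_bigr b) ?bM // => i _.
  by rewrite cabs_real ger0_norm.
move=> e e0; have [x [t0 [u0 ->]] hx] := sup_adherent e0 supE.
exists t0 => t ut sub.
have -> : \sum_(i <- t) (b i)%:C%C - (sup E)%:C%C = (\sum_(i <- t) b i - sup E)%:C%C :> C.
  by rewrite rmorphB /= rmorph_sum.
have h1 := ler_sum_subset u0 ut sub b0.
have h2 : \sum_(i <- t) b i <= sup E by apply: ub_le_sup => //; exists t.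
by rewrite cabs_real ler0_norm; lra.
Qed.

(** Real and imaginary parts are dominated by the modulus, and a real series is half the difference
    of the nonnegative series with terms [|x| + x] and [|x| - x]. *)
Lemma asum_exists (I : eqType) (a : I -> C) (M : R) :
  (forall t, uniq t -> \sum_(i <- t) cabs (a i) <= M) -> exists s, asum a s.
Proof.
move=> aM.
have H (f : C -> R) : (forall x, `|f x| <= cabs x) ->
    exists s, asum (fun i => (f (a i))%:C%C : C) s.
  move=> hf.
  have H1 e : `|e| = 1 -> exists s, asum (fun i => (`|f (a i)| + e * f (a i))%:C%C : C) s.
    move=> e1; apply: (@asum_real_exists _ _ (M + M)) => [i|t ut].
      have := ler_norm (- (e * f (a i))); rewrite normrN normrM e1 mul1r; lra.
    apply: le_trans (lerD (aM t ut) (aM t ut)); rewrite -big_split /=.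
    apply: ler_sum => i _; apply: lerD (hf _) _.
    by apply: le_trans (ler_norm _) _; rewrite normrM e1 mul1r.
  have [s1 H2] := H1 1 (normr1 _); have [s2 H3] := H1 (-1) (normrN1 _).
  exists (2^-1 * (s1 - s2)); apply: eq_asum (asumZ _ (asumB H2 H3)) => i.
  rewrite -rmorphB /= (_ : (2^-1 : C) = (2^-1 : R)%:C%C); last first.
    by rewrite fmorphV rmorph_nat.
  rewrite -rmorphM /=; by congr (_%:C%C); field.
have [s1 H1] := H _ (@Re_le_cabs R); have [s2 H2] := H _ (@Im_le_cabs R).
exists (s1 + 'i%C * s2); apply: eq_asum (asumD H1 (asumZ _ H2)) => i.
by rewrite [RHS]complexE.
Qed.

Lemma asum_tail (I : eqType) (a : I -> C) (s : C) (e : R) : asum a s -> 0 < e ->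
  exists t0, uniq t0 /\ forall t, uniq t -> (forall i, i \in t -> i \notin t0) ->
    \sum_(i <- t) cabs (a i) < e.
Proof.
move=> [[M HM] _] e0.
pose E : set R := [set x | exists t, uniq t /\ x = \sum_(i <- t) cabs (a i)]%classic.
have ubE : has_ubound E by exists M => x [t [ut ->]]; exact: HM.
have supE : has_sup E by split => //; exists 0, [::]; rewrite big_nil.
have [x [t0 [u0 ->]] hx] := sup_adherent e0 supE.
exists t0; split=> // t ut dis.
have h2 : \sum_(i <- t0 ++ t) cabs (a i) <= sup E.
  apply: ub_le_sup => //; exists (t0 ++ t); split=> //.
  by rewrite cat_uniq u0 ut andbT /=; apply/hasPn => i /dis.
by rewrite big_cat /= in h2; lra.
Qed.

Lemma asum_group (I K : eqType) (f : I -> K) (fib : K -> seq I) (a : I -> C) s :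
  (forall k, uniq (fib k)) -> (forall k i, (i \in fib k) = (f i == k)) ->
  asum a s -> asum (fun k => \sum_(i <- fib k) a i) s.
Proof.
move=> ufib mfib [[M HM] H].
have uT t : uniq t -> uniq (flatten (map fib t)).
  elim: t => //= k t IH /andP[kt ut]; rewrite cat_uniq ufib IH // andbT.
  apply/hasPn => i /flattenP[l /mapP[k' k't ->]]; rewrite !mfib => /eqP ->.
  by apply: contraNneq kt => <-.
split.
  exists M => t ut; apply: le_trans (HM _ (uT _ ut)).
  by rewrite big_flatten big_map; apply: ler_sum => k _; exact: cabs_sum.
move=> e e0; have [t0 Ht] := H _ e0; exists (map f t0) => t ut sub.
have -> : \sum_(k <- t) \sum_(i <- fib k) a i = \sum_(i <- flatten (map fib t)) a i.
  by rewrite big_flatten big_map.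
apply: Ht; first exact: uT.
move=> i it; apply/flattenP; exists (fib (f i)); last by rewrite mfib.
by apply: map_f; apply: sub; apply: map_f.
Qed.

(** The product of the bounds gives some sum [x]; partial sums over large rectangles identify it
    with [s * r]. *)
Lemma asum_mul (I J : eqType) (a : I -> C) (b : J -> C) s r : asum a s -> asum b r ->
  asum (fun p : I * J => a p.1 * b p.2) (s * r).
Proof.
move=> Ha Hb; have [[M HM] H] := Ha; have [[N HN] K] := Hb.
have M0 : 0 <= M by have := HM [::] isT; rewrite big_nil.
have N0 : 0 <= N by have := HN [::] isT; rewrite big_nil.
have urect t1 t2 : uniq t1 -> uniq t2 -> uniq [seq (i, j) | i <- t1 : seq I, j <- t2 : seq J].
  by move=> u1 u2; rewrite allpairs_uniq // => -[x1 x2] [y1 y2] _ _ [-> ->].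
have srect t1 t2 (V : comRingType) (F : I -> V) (G : J -> V) :
   \sum_(p <- [seq (i, j) | i <- t1 : seq I, j <- t2 : seq J]) F p.1 * G p.2 =
   (\sum_(i <- t1) F i) * (\sum_(j <- t2) G j).
  by rewrite big_allpairs_dep /= big_distrlr.
have [|x Hx] := @asum_exists _ (fun p : I * J => a p.1 * b p.2) (M * N).
  move=> t ut; rewrite (eq_bigr (fun p : I * J => cabs (a p.1) * cabs (b p.2))); last first.
    by move=> i _; rewrite cabsM.
  pose t1 := undup (map fst t); pose t2 := undup (map snd t).
  have u1 : uniq t1 := undup_uniq _; have u2 : uniq t2 := undup_uniq _.
  apply: le_trans (ler_sum_subset (t := [seq (i, j) | i <- t1, j <- t2]) ut _ _ _) _.
  - exact: urect.
  - move=> [i j] ijt; apply/allpairsP; exists (i, j).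
    by rewrite !mem_undup (map_f fst ijt) (map_f snd ijt).
  - by move=> p; rewrite mulr_ge0 ?cabs_ge0.
  - rewrite (srect t1 t2 R (fun i => cabs (a i)) (fun j => cabs (b j))).
    by apply: ler_pM; rewrite ?HM ?HN ?sumr_ge0 // => i _; rewrite cabs_ge0.
suff -> : s * r = x by [].
apply/eqP; rewrite -subr_eq0 -cabs_eq0 eq_le cabs_ge0 andbT leNgt; apply/negP => h.
set e := cabs (s * r - x) in h; have [_ L] := Hx.
have e2 : 0 < e / 2 by rewrite divr_gt0.
have s0 := cabs_ge0 s; have r0 := cabs_ge0 r.
have c0 : 0 < cabs r + cabs s + 1 by lra.
(* The bound 1 gives [cabs B <= cabs r + 1]; the other one makes the error on the rectangle at most
   [e / 2]. *)
pose d := Num.min 1 (e / 2 / (cabs r + cabs s + 1)).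
have d0 : 0 < d by rewrite lt_min ltr01 !divr_gt0.
have [t0 H0] := L _ e2; have [p1 H1] := H _ d0; have [p2 H2] := K _ d0.
pose t1 := undup (p1 ++ map fst t0); pose t2 := undup (p2 ++ map snd t0).
have u1 : uniq t1 := undup_uniq _; have u2 : uniq t2 := undup_uniq _.
have := H0 [seq (i, j) | i <- t1, j <- t2] (urect _ _ u1 u2) _.
rewrite srect => /(_ _) k0.
set A := \sum_(i <- t1) a i in k0; set B := \sum_(j <- t2) b j in k0.
have k1 : cabs (A - s) < d by apply: H1 => // i it; rewrite mem_undup mem_cat it.
have k2 : cabs (B - r) < d by apply: H2 => // i it; rewrite mem_undup mem_cat it.
have k3 : cabs (A * B - x) < e / 2.
  apply: k0 => -[i j] ijt; apply/allpairsP; exists (i, j).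
  by rewrite !mem_undup !mem_cat (map_f fst ijt) (map_f snd ijt) !orbT.
have k4 : e <= cabs (A * B - x) + cabs (A * B - s * r).
  by rewrite (cabsB _ (s * r)) addrC; apply: le_trans (cabsD _ _); rewrite subrKA.
have k5 : cabs (A * B - s * r) <= cabs (A - s) * cabs B + cabs s * cabs (B - r).
  rewrite -!cabsM; apply: le_trans (cabsD _ _); rewrite mulrBl mulrBr subrKA //.
have k6 : cabs B <= cabs r + 1.
  have d1 : d <= 1 by rewrite ge_min lexx.
  by have := cabsD (B - r) r; rewrite subrK; lra.
have k7 : cabs (A - s) * cabs B + cabs s * cabs (B - r) <= d * (cabs r + cabs s + 1).
  have := ler_pM (cabs_ge0 _) (cabs_ge0 _) (ltW k1) k6.
  have := ler_wpM2l s0 (ltW k2); lra.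
have k8 : d * (cabs r + cabs s + 1) <= e / 2.
  by rewrite -ler_pdivlMr // ge_min lexx orbT.
lra.
Qed.

Lemma asum_cauchy (a b : nat -> C) s r : asum a s -> asum b r ->
  asum (fun k => \sum_(j < k.+1) a (k - j)%N * b j) (s * r).
Proof.
move=> Ha Hb.
pose fib k := [seq ((k - j)%N, j) | j <- iota 0 k.+1].
have := asum_group (f := fun p : nat * nat => (p.1 + p.2)%N) (fib := fib) _ _ (asum_mul Ha Hb).
move=> /(_ _ _) H; apply: eq_asum (H _ _).
- by move=> k; rewrite big_map /= -(big_mkord xpredT (fun j => a (k - j)%N * b j)).
- by move=> k; rewrite map_inj_uniq ?iota_uniq // => i j [].
- move=> k [i j] /=; apply/mapP/eqP => [[j' ] |<-].
    by rewrite mem_iota /= add0n ltnS => h [-> ->]; rewrite subnK.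
  by exists j; rewrite ?mem_iota /= ?add0n ?ltnS ?leq_addl // addnK.
Qed.

End SumExistence.

(** * Uniqueness of Laurent coefficients *)

Section TorusUniqueness.
Variable R : realType.
Local Notation C := R[i].

Lemma complex_prim_root_exists M : (0 < M)%N -> exists x : C, M.-primitive_root x.
Proof.
move=> M0; pose p : {poly C} := 'X^M - 1; have [r Dp] := closed_field_poly_normal p.
rewrite (monicP _) ?monicXnsubC // scale1r in Dp.
have rn1 : all M.-unity_root r by apply/allP => z; rewrite -root_prod_XsubC -Dp.
have sz_r : (M < (size r).+1)%N by rewrite -(size_prod_XsubC r id) -Dp size_XnsubC.
have [|z] := hasP (has_prim_root M0 rn1 _ sz_r); last by exists z.
by rewrite -separable_prod_XsubC -Dp separable_Xn_sub_1 // pnatr_eq0 -lt0n.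
Qed.

Lemma cabs_unity_root M (x : C) : (0 < M)%N -> x ^+ M = 1 -> cabs x = 1.
Proof.
move=> M0 xM; apply/eqP; rewrite -(@pexpr_eq1 _ _ M) ?cabs_ge0 // -cabsX xM.
by rewrite cabs1.
Qed.

(* Averaging over the M-th roots of unity isolates the exponents congruent to *)
(* [e0] modulo M; for large M the other ones lie in an arbitrarily small tail. *)
Lemma torus_coef_eq0 n (r : 'I_n -> R) (c : {ffun 'I_n -> int} -> C) :
  (forall i, 0 < r i) ->
  (forall z : 'I_n -> C, (forall i, cabs (z i) = r i) ->
     asum (fun e : {ffun 'I_n -> int} => c e * \prod_i z i ^ e i) 0) ->
  forall e, c e = 0.
Proof.
move=> r0 H e0.
have rC i : (r i)%:C%C != 0 :> C by rewrite -cabs_eq0 cabs_real normr_eq0 gt_eqF.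
pose a e := c e * \prod_i (r i)%:C%C ^ e i.
suff : a e0 = 0.
  move/eqP; rewrite mulf_eq0 => /orP[/eqP//|/prodf_eq0 [i _]].
  by rewrite expfz_eq0 (negbTE (rC i)) andbF.
apply/eqP; rewrite -cabs_eq0 eq_le cabs_ge0 andbT; apply/ler_addgt0Pr => eps eps0.
rewrite add0r.
have Ha : asum a 0.
  by apply: H => i; rewrite cabs_real gtr0_norm.
have eps2 : 0 < eps / 2 by rewrite divr_gt0.
have [t0 [u0 tail]] := asum_tail Ha eps2.
(* [M] exceeds every [|e i - e0 i|] with [e] in [t0], so [e0] is the only element of [t0] that can
   be congruent to [e0] modulo [M]. *)
pose M := (\sum_(e <- t0) \sum_i `|e i - e0 i|%N).+1.
have M0 : (0 < M)%N by [].
have [w prim_w] := complex_prim_root_exists M0.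
have w0 : w != 0 by rewrite (prim_root_eq0 prim_w).
have w1 : cabs w = 1 by apply: cabs_unity_root M0 (prim_expr_order prim_w).
pose S (d : int) := \sum_(j < M) (w ^ d) ^+ j.
pose G (e : {ffun 'I_n -> int}) := \prod_i S (e i - e0 i).
have cabswd d : cabs (w ^ d) = 1.
  by rewrite cabsXz w1 exp1rz.
have Sle d : cabs (S d) <= M%:R.
  apply: le_trans (cabs_sum _ _ _) _.
  rewrite (eq_bigr (fun=> 1)) ?sumr_const ?card_ord // => j _.
  by rewrite cabsX cabswd expr1n.
have Gle e : cabs (G e) <= M%:R ^+ n.
  rewrite /G -[n in leRHS]card_ord -prodr_const.
  elim/big_ind2: _ => [|x1 x2 y1 y2 h1 h2|i _]; rewrite ?cabs1 ?Sle //.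
  by rewrite cabsM ler_pM ?cabs_ge0.
have S_eq0 d : (`|d| < M)%N -> d != 0 -> S d = 0.
  move=> dM d0; have wdM : (w ^ d) ^+ M = 1.
    by rewrite exprnP exprz_exp mulrC -exprz_exp -exprnP (prim_expr_order prim_w) exp1rz.
  have wd1 : w ^ d != 1.
    apply: contraNneq d0 => wd1.
    have : w ^+ `|d| = 1.
      case: (d) wd1 => m; first by rewrite -exprnP.
      by rewrite NegzE -exprnN => h; apply: invr_inj; rewrite h invr1.
    move/eqP; rewrite -(prim_order_dvd prim_w) => /dvdn_leq h.
    by move: dM h; clearbody M; lia.
  apply/eqP; have : (w ^ d - 1) * S d == 0 by rewrite -subrX1 wdM subrr.
  by rewrite mulf_eq0 subr_eq0 (negbTE wd1).
(* The hypothesis at the point [r i * w ^ t i], multiplied by the power of [w] that makes the term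
   at [e0] independent of [t]. *)
have Hz (t : {ffun 'I_n -> 'I_M}) :
    asum (fun e => a e * \prod_i (w ^ (e i - e0 i)) ^+ t i) 0.
  have Ht : asum (fun e : {ffun 'I_n -> int} =>
      c e * \prod_i ((r i)%:C%C * w ^+ t i) ^ e i) 0.
    apply: H => i; rewrite cabsM cabsX w1 expr1n mulr1 cabs_real gtr0_norm //.
  have := asumZ (\prod_i (w ^ (- e0 i)) ^+ t i) Ht; rewrite mulr0.
  apply: eq_asum => e; rewrite /a mulrCA -!mulrA; congr (_ * _).
  rewrite -!big_split /=; apply: eq_bigr => i _.
  rewrite expfzMl mulrCA; congr (_ * _).
  rewrite expfzDr // exprMn [RHS]mulrC; congr (_ * _).
  by rewrite !exprnP !exprz_exp mulrC.
have HG : asum (fun e => a e * G e) 0.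
  have := asum_sum (index_enum ({ffun 'I_n -> 'I_M} : finType)) Hz; rewrite big1 //.
  apply: eq_asum => e; rewrite -mulr_sumr; congr (_ * _).
  by rewrite /G /S (bigA_distr_bigA (fun i (j : 'I_M) => (w ^ (e i - e0 i)) ^+ j)).
have Mn0 : 0 < M%:R ^+ n :> R by rewrite exprn_gt0 // ltr0n.
have [t1 Ht1] := HG.2 _ (mulr_gt0 eps2 Mn0).
pose T := undup (t1 ++ t0 ++ [:: e0]).
have uT : uniq T := undup_uniq _.
have hT : cabs (\sum_(e <- T) a e * G e) < eps / 2 * M%:R ^+ n.
  rewrite -[X in cabs X]subr0; apply: Ht1 => // e et.
  by rewrite mem_undup mem_cat et.
have e0T : e0 \in T by rewrite mem_undup !mem_cat inE eqxx !orbT.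
rewrite (bigD1_seq e0) //= in hT.
have G0 : G e0 = M%:R ^+ n.
  rewrite /G (eq_bigr (fun=> M%:R)) ?prodr_const ?card_ord // => i _.
  by rewrite subrr /S (eq_bigr (fun=> 1)) ?sumr_const ?card_ord // => j _; rewrite expr1n.
(* Terms of [t0] have a vanishing factor [S (e i - e0 i)]; the others lie in the tail, where [G] is
   at most [M ^ n]. *)
have rest : cabs (\sum_(e <- T | e != e0) a e * G e) <= eps / 2 * M%:R ^+ n.
  rewrite (bigID (mem t0)) /= big1_seq ?add0r; last first.
    move=> e /andP[/andP[ne et0] _].
    have [i Hi] : exists i, e i != e0 i.
      apply/existsP; apply: contra_neqT ne; rewrite negb_exists => /forallP h.
      by apply/ffunP => i; apply/eqP; have := h i; rewrite negbK.
    rewrite /G (bigD1 i) //= S_eq0 ?mul0r ?mulr0 ?subr_eq0 //.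
    rewrite ltnS (big_rem e) //= (bigD1 i) //= -addnA leq_addr //.
  apply: le_trans (cabs_sum _ _ _) _.
  apply: (@le_trans _ _ (\sum_(e <- [seq e <- T | (e != e0) && (e \notin t0)]) cabs (a e) * M%:R ^+ n)).
    rewrite big_filter; apply: ler_sum => e _; rewrite cabsM ler_wpM2l ?cabs_ge0 //.
  rewrite -mulr_suml ler_wpM2r ?ltW // tail ?filter_uniq // => e.
  by rewrite mem_filter => /andP[/andP[]].
rewrite G0 in hT; set Y := \sum_(e <- T | e != e0) _ in hT rest.
have h : cabs (a e0) * M%:R ^+ n <= cabs (a e0 * M%:R ^+ n + Y) + cabs Y.
  have := cabsD (a e0 * M%:R ^+ n + Y) (- Y).
  by rewrite addrK cabsN cabsM cabsX cabs_nat.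
rewrite -(ler_pM2r Mn0); apply: le_trans h _.
move: rest hT; set A := cabs (_ + _); set B := cabs Y; set D := _ ^+ n.
by clear; move=> h1 /ltW h2; rewrite [X in X * _]splitr mulrDl lerD.
Qed.

End TorusUniqueness.

(** * Binomial series *)

Section GeneralizedBinomial.
Variable F : numFieldType.
Implicit Types (x y : F) (k j n : nat).

Lemma gbinom0 x : gbinom x 0 = 1.
Proof. by rewrite /gbinom big_ord0 fact0 divr1. Qed.

Lemma gbinomS x k : k.+1%:R * gbinom x k.+1 = (x - k%:R) * gbinom x k.
Proof.
rewrite /gbinom big_ord_recr /= factS natrM.
have h1 : k.+1%:R != 0 :> F by rewrite pnatr_eq0.
have h2 : (k`!)%:R != 0 :> F by rewrite pnatr_eq0 -lt0n fact_gt0.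
by field; rewrite h2 addrC natr1.
Qed.

(** Induction on [k]: multiply by [k.+1 = (k.+1 - j) + j] and lower the index of one factor with
    [gbinomS]. *)
Lemma gbinom_Vandermonde x y k :
  \sum_(j < k.+1) gbinom x (k - j) * gbinom y j = gbinom (x + y) k.
Proof.
elim: k => [|k IH]; first by rewrite big_ord1 !gbinom0 mulr1.
have k0 : k.+1%:R != 0 :> F by rewrite pnatr_eq0.
apply: (mulfI k0); rewrite gbinomS -IH !mulr_sumr.
have -> : \sum_(j < k.+2) k.+1%:R * (gbinom x (k.+1 - j) * gbinom y j) =
  \sum_(j < k.+2) (k.+1 - j)%:R * gbinom x (k.+1 - j) * gbinom y j +
  \sum_(j < k.+2) gbinom x (k.+1 - j) * (j%:R * gbinom y j).
  rewrite -big_split /=; apply: eq_bigr => j _.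
  by rewrite natrB -1?ltnS //; ring.
rewrite big_ord_recr /= subnn mulr0n !mul0r addr0 [X in _ + X = _]big_ord_recl /=.
rewrite mulr0n mul0r mulr0 add0r.
rewrite -big_split /=; apply: eq_bigr => j _.
have jk : (j <= k)%N by rewrite -ltnS.
rewrite subSn // gbinomS /bump /= add1n subSS gbinomS natrB //; ring.
Qed.

Lemma gbinom_0 k : gbinom (0 : F) k = (k == 0%N)%:R.
Proof.
case: k => [|k]; first exact: gbinom0.
by rewrite /gbinom big_ord_recl /= subrr !mul0r.
Qed.

Lemma gbinom_1 k : gbinom (1 : F) k = (k <= 1)%N%:R.
Proof.
case: k => [|[|k]]; first exact: gbinom0.
  by rewrite /gbinom big_ord1 subr0 divr1.
by rewrite /gbinom !big_ord_recl /= subrr mul0r mulr0 mul0r.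
Qed.

Lemma gbinom_Pascal x k : gbinom (x + 1) k.+1 = gbinom x k.+1 + gbinom x k.
Proof.
rewrite -gbinom_Vandermonde big_ord_recl big_ord_recl big1 /=.
  by rewrite !gbinom_1 /= !mulr1 addr0 subn0 subSS subn0.
by move=> j _; rewrite gbinom_1 /= mulr0.
Qed.

Lemma gbinom_nat n k : gbinom (n%:R : F) k = 'C(n, k)%:R.
Proof.
elim: n k => [|n IH] [|k]; rewrite ?gbinom0 ?bin0 //; first by rewrite gbinom_0.
by rewrite -natr1 gbinom_Pascal !IH binS natrD.
Qed.

End GeneralizedBinomial.

Section BinomialSeries.
Variable R : realType.
Local Notation C := R[i].
Implicit Types (a b w : C) (r : R).

(** The bound is the coefficient of [r ^ k] in [(1 - r)^(-M-1)], whose partial sums are easy to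
    control. *)
Lemma cabs_gbinom_le a (M k : nat) : cabs a <= M%:R -> cabs (gbinom a k) <= 'C(M + k, k)%:R.
Proof.
move=> aM; elim: k => [|k IH]; first by rewrite gbinom0 cabs1 bin0.
have k0 : 0 < k.+1%:R :> R by rewrite ltr0n.
rewrite -(ler_pM2l k0) -{1}(cabs_nat R k.+1) -cabsM gbinomS cabsM addnS -natrM -mul_bin_diag.
rewrite natrM ler_pM ?cabs_ge0 //.
have := cabsD a (- k%:R); rewrite cabsN cabs_nat => h.
apply: le_trans h _; rewrite -natr1 natrD; lra.
Qed.

Lemma sum_binom_le r (M K : nat) : 0 <= r -> r < 1 ->
  \sum_(k < K) 'C(M + k, k)%:R * r ^+ k <= (1 - r) ^- M.+1.
Proof.
move=> r0 r1; have r1' : 0 < 1 - r by lra.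
elim: M K => [|M IH] K.
  rewrite expr1 -(ler_pM2l r1') mulfV ?gt_eqF //.
  rewrite (eq_bigr (fun k : 'I_K => r ^+ k)) => [|k _]; last by rewrite add0n binn mul1r.
  have -> : (1 - r) * \sum_(k < K) r ^+ k = 1 - r ^+ K.
    by rewrite -opprB mulNr -subrX1 opprB.
  by rewrite gerBl exprn_ge0.
(* By Pascal's rule, multiplication by [1 - r] lowers [M], up to a nonnegative remainder. *)
have key m : \sum_(k < m.+1) 'C(M + k, k)%:R * r ^+ k -
    (1 - r) * \sum_(k < m.+1) 'C(M.+1 + k, k)%:R * r ^+ k = 'C(M.+1 + m, m)%:R * r ^+ m.+1.
  elim: m => [|m IHm].
    by rewrite !big_ord1 !bin0 /=; ring.
  rewrite big_ord_recr /= [X in (1 - r) * X]big_ord_recr /=.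
  move: IHm; set A := \sum_(k < m.+1) _; set B := \sum_(k < m.+1) _ => IHm.
  rewrite mulrDr opprD addrACA IHm !addnS !addSn.
  rewrite (binS (M + m).+1 m) natrD !exprS; ring.
have le1 : (1 - r) * \sum_(k < K) 'C(M.+1 + k, k)%:R * r ^+ k <=
    \sum_(k < K) 'C(M + k, k)%:R * r ^+ k.
  case: K => [|K]; first by rewrite !big_ord0 mulr0.
  by rewrite -subr_ge0 key mulr_ge0 ?exprn_ge0.
rewrite -(ler_pM2l r1') [leRHS](_ : _ = (1 - r) ^- M.+1).
  exact: le_trans le1 (IH K).
by rewrite [in LHS]exprS invfM mulrA mulfV ?mul1r // gt_eqF.
Qed.

(** The sum stands for [(1 + w)^a] without any choice of branch. *)
Definition binom_sums a w s := asum (fun k => gbinom a k * w ^+ k) s.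

Lemma sum_nat_seq_le (G : nat -> R) (B : R) : (forall k, 0 <= G k) ->
  (forall K, \sum_(k < K) G k <= B) -> forall t, uniq t -> \sum_(k <- t) G k <= B.
Proof.
move=> G0 GB t ut; apply: le_trans (GB (\max_(k <- t) k).+1).
rewrite -(big_mkord xpredT G) /index_iota; apply: ler_sum_subset => //.
  exact: iota_uniq.
by move=> k kt; rewrite mem_iota subn0 /= ltnS; exact: leq_bigmax_seq.
Qed.

Lemma binom_sums_exists a w : cabs w < 1 -> exists s, binom_sums a w s.
Proof.
move=> w1; pose M := Num.bound (cabs a).
have aM : cabs a <= M%:R by rewrite ltW // archi_boundP ?cabs_ge0.
apply: (@asum_exists _ _ _ ((1 - cabs w) ^- M.+1)).
apply: sum_nat_seq_le => [k|K]; first exact: cabs_ge0.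
apply: le_trans (sum_binom_le M K (cabs_ge0 w) w1); apply: ler_sum => k _.
by rewrite cabsM cabsX ler_wpM2r ?exprn_ge0 ?cabs_ge0 ?cabs_gbinom_le.
Qed.

Lemma binom_sumsD a b w s (t : C) : binom_sums a w s -> binom_sums b w t ->
  binom_sums (a + b) w (s * t).
Proof.
move=> Ha Hb; apply: eq_asum (asum_cauchy Ha Hb) => k /=.
rewrite -gbinom_Vandermonde mulr_suml; apply: eq_bigr => j _.
have jk : (j <= k)%N by rewrite -ltnS.
by rewrite mulrACA -exprD subnK.
Qed.

Lemma binom_sums_nat n w : binom_sums n%:R w ((1 + w) ^+ n).
Proof.
elim: n => [|n IH].
  rewrite expr0 /binom_sums; have := asum_fin (t0 := [:: 0%N]) (a := fun k => gbinom 0 k * w ^+ k) isT.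
  rewrite big_seq1 gbinom0 mulr1; apply => -[|k] //.
  by rewrite gbinom_0 mul0r.
rewrite -natr1 exprSr; apply: binom_sumsD IH _.
have := asum_fin (t0 := [:: 0%N; 1%N]) (a := fun k => gbinom 1 k * w ^+ k) isT.
rewrite big_cons big_seq1 !gbinom_1 /= !mul1r expr0 expr1; apply => -[|[|k]] //.
by rewrite gbinom_1 mul0r.
Qed.

(** For a negative exponent, the product with the series of the opposite exponent is the series of
    exponent 0, whose sum is 1. *)
Lemma binom_sums_int (m : int) w : cabs w < 1 -> binom_sums m%:~R w ((1 + w) ^ m).
Proof.
move=> w1; case: m => n; first exact: binom_sums_nat.
have [s Hs] := binom_sums_exists (- n.+1%:R) w1.
have := binom_sumsD Hs (binom_sums_nat n.+1 w); rewrite addNr => H.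
have := asum_unique H (binom_sums_nat 0 w); rewrite expr0 => e.
rewrite NegzE mulrNz -exprnN; suff <- : s = (1 + w) ^- n.+1 by [].
have h : (1 + w) ^+ n.+1 != 0.
  by apply: contra_eq_neq e => /= ->; rewrite mulr0 eq_sym oner_eq0.
by apply: (mulIf h); rewrite e mulVf.
Qed.

(** The moduli of the binomial coefficients of 1/2 of index at least 1 have partial sums at most 1.
    The estimate puts the sum in the right half-plane, which singles out one square root of
    [1 + w]. *)
Lemma binom_sums_half_near1 w s : cabs w < 1 -> binom_sums 2^-1 w s -> cabs (s - 1) <= cabs w.
Proof.
move=> w1 [_ H]; pose q k : R := cabs (gbinom (2^-1 : C) k).
have q0 : q 0%N = 1 by rewrite /q gbinom0 cabs1.
have qS k : k.+2%:R * q k.+2 = (k%:R + 2^-1) * q k.+1.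
  rewrite /q -(cabs_nat R k.+2) -cabsM gbinomS cabsM; congr (_ * _).
  rewrite -cabsN opprB (_ : _ - _ = (k%:R + 2^-1 : R)%:C%C).
    by rewrite cabs_real ger0_norm ?addr_ge0 ?invr_ge0.
  by rewrite rmorphD /= fmorphV /= !rmorph_nat -natr1; field.
have q1 : q 1%N = 2^-1.
  by rewrite /q /gbinom big_ord1 subr0 divr1 cabsV cabs_nat.
(* An exact formula for the remainder, whose sign gives the bound 1. *)
have sq K : 1 - \sum_(k < K) q k.+1 = 2 * K.+1%:R * q K.+1.
  elim: K => [|K IH]; first by rewrite big_ord0 q1; field.
  rewrite big_ord_recr /= opprD addrA IH -[RHS]mulrA qS.
  by rewrite -natr1; field.
have sq1 K : \sum_(k < K) q k.+1 <= 1.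
  by rewrite -subr_ge0 sq mulr_ge0 ?cabs_ge0.
have tq t : uniq t -> \sum_(k <- t | k != 0%N) cabs (gbinom (2^-1 : C) k * w ^+ k) <= cabs w.
  move=> ut; rewrite -big_filter.
  apply: (@le_trans _ _ (\sum_(k <- [seq i <- t | i != 0%N]) (k != 0)%N%:R * q k * cabs w)).
    rewrite big_seq [leRHS]big_seq; apply: ler_sum => k.
    rewrite mem_filter => /andP[k0 _]; rewrite k0 mul1r cabsM cabsX ler_wpM2l ?cabs_ge0 //.
    rewrite -[leRHS]expr1 ler_wiXn2l ?cabs_ge0 ?lt0n // ltW //.
  rewrite -mulr_suml ler_piMl ?cabs_ge0 //.
  apply: (sum_nat_seq_le (G := fun k => (k != 0)%N%:R * q k)).
  - by move=> k; rewrite mulr_ge0 ?ler0n ?cabs_ge0.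
  - case=> [|K]; first by rewrite big_ord0.
    rewrite big_ord_recl /= mul0r add0r; apply: le_trans (sq1 K).
    by apply: ler_sum => k _; rewrite mul1r.
  - by rewrite filter_uniq.
apply/ler_addgt0Pr => e e0; have [t0 Ht] := H _ e0.
pose t := undup (0%N :: t0); have ut : uniq t := undup_uniq _.
have h1 : cabs (\sum_(k <- t) gbinom 2^-1 k * w ^+ k - s) < e.
  by apply: Ht => // k kt; rewrite mem_undup inE kt orbT.
rewrite (bigD1_seq 0%N) //= ?mem_undup ?inE ?eqxx // gbinom0 mulr1 in h1.
set Y := \sum_(k <- t | _) _ in h1.
have h2 : cabs Y <= cabs w by apply: le_trans (cabs_sum _ _ _) (tq _ ut).
have := cabsD Y (- (1 + Y - s)); rewrite cabsN.
have -> : Y + - (1 + Y - s) = s - 1 by ring.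
lra.
Qed.

End BinomialSeries.

(** * Branches of the logarithm and of the square root *)

Section Branches.
Import numFieldNormedType.Exports.
Variable R : realType.
Local Notation C := R[i].
Implicit Types (z l : C) (p m : int).

Lemma cexpD l l' : cexp (l + l') = cexp l * cexp l'.
Proof.
case: l l' => a b [c d]; rewrite /cexp /= expRD rmorphM /= mulrACA; congr (_ * _).
by rewrite cosD sinD; apply/eqP; rewrite eq_complex /=; apply/andP; split; apply/eqP; ring.
Qed.

Lemma cexp0 : cexp 0 = 1 :> C.
Proof. by rewrite /cexp /= expR0 cos0 sin0 mul1r. Qed.

Lemma cexp_neq0 l : cexp l != 0.
Proof.
apply/eqP => e; have := cexpD l (- l); rewrite e mul0r subrr cexp0.
by move/eqP; rewrite oner_eq0.
Qed.

Lemma cexp_nat (k : nat) l : cexp (k%:R * l) = cexp l ^+ k.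
Proof.
elim: k => [|k IH]; first by rewrite mul0r cexp0.
by rewrite -natr1 mulrDl cexpD IH mul1r exprSr.
Qed.

Lemma cexp_int m l : cexp (m%:~R * l) = cexp l ^ m.
Proof.
case: m => k; first exact: cexp_nat.
rewrite NegzE mulrNz mulNr -exprnN; apply: (mulIf (cexp_neq0 (k.+1%:R * l))).
by rewrite -cexpD addNr cexp0 cexp_nat mulVf // expf_neq0 ?cexp_neq0.
Qed.

Lemma cargP z : z != 0 -> [/\ 0 <= carg z, carg z < 2 * pi &
  z = (cabs z)%:C%C * (cos (carg z) +i* sin (carg z))%C].
Proof.
move=> z0.
suff [t ht] : exists t : R, [/\ 0 <= t, t < 2 * pi &
    z = (cabs z)%:C%C * (cos t +i* sin t)%C].
  exact: (@getI _ [set t : R | [/\ 0 <= t, t < 2 * pi &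
    z = (cabs z)%:C%C * (cos t +i* sin t)%C]]%classic t ht).
have r0 : 0 < cabs z by rewrite cabs_gt0.
have r2 : cabs z ^+ 2 = complex.Re z ^+ 2 + complex.Im z ^+ 2.
  by apply: complexI; rewrite rmorphXn /= cabsE -add_Re2_Im2.
case: z z0 r0 r2 => x y /= z0; set r := cabs _ => r0 r2.
have c1 : -1 <= x / r <= 1.
  by rewrite -ler_norml normrM normfV (gtr0_norm r0) ler_pdivrMr // mul1r; exact: (Re_le_cabs (x +i* y)%C).
have xE : x = r * (x / r) by rewrite mulrC divfK ?gt_eqF.
have sE : r * sin (acos (x / r)) = `|y|.
  rewrite sin_acos // -{1}(gtr0_norm r0) -sqrtr_sqr -sqrtrM ?sqr_ge0 // -sqrtr_sqr.
  by congr (Num.sqrt _); rewrite mulrBr mulr1 -exprMn -xE r2; ring.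
have pi0 := pi_gt0 R.
case: (leP 0 y) => y0.
  exists (acos (x / r)); split; rewrite ?acos_ge0 //.
    by have := acos_lepi c1; lra.
  apply/eqP; rewrite eq_complex /= acosK ?in_itv //= !mul0r subr0 addr0 -xE eqxx /=.
  by rewrite sE ger0_norm.
have a0 : 0 < acos (x / r).
  rewrite lt_neqAle acos_ge0 // andbT; apply/negP => /eqP e.
  by move: sE; rewrite -e sin0 mulr0 => /eqP; rewrite eq_sym normr_eq0 lt_eqF.
exists (2 * pi - acos (x / r)); split.
- by have := acos_lepi c1; lra.
- by lra.
- have e : 2 * pi - acos (x / r) = - acos (x / r) + pi *+ 2 by rewrite mulr2n; ring.
  apply/eqP; rewrite e eq_complex /= cosD2pi sinD2pi cosN sinN acosK ?in_itv //=.
  by rewrite !mul0r subr0 addr0 -xE eqxx /= mulrN sE ltr0_norm ?opprK.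
Qed.

Lemma cexp_clog p z : z != 0 -> cexp (clog p z) = z.
Proof.
move=> z0; have [_ _ zE] := cargP z0; rewrite [RHS]zE.
rewrite /cexp /clog /= lnK ?posrE ?cabs_gt0 //; congr (_ * _).
have per (f : R -> R) (k : nat) : (forall x, f (x + pi *+ 2) = f x) ->
    forall x, f (x + 2 * pi * k%:R) = f x.
  move=> fp; elim: k => [|k IH] x; first by rewrite mulr0 addr0.
  rewrite (_ : x + _ = x + 2 * pi * k%:R + pi *+ 2) ?fp ?IH //.
  by rewrite -[k.+1%:R]natr1 mulr2n; ring.
have perz (f : R -> R) : (forall x, f (x + pi *+ 2) = f x) ->
    forall x, f (x + 2 * pi * p%:~R) = f x.
  move=> fp x; case: p => k; first exact: per.
  by rewrite NegzE mulrNz mulrN -[in RHS](subrK (2 * pi * k.+1%:R) x) per.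
by rewrite !perz // => x; rewrite ?cosD2pi ?sinD2pi.
Qed.

Lemma sqrt_unique (s t : C) : s ^+ 2 = t ^+ 2 -> 0 < complex.Re s -> 0 < complex.Re t -> s = t.
Proof.
move=> /eqP; rewrite eqf_sqr => /orP[/eqP//|/eqP ->]; case: t => a b /= h1 h2; exfalso; lra.
Qed.

(** Both values are square roots of [z / z'] with positive real part: the series because its
    distance to 1 is less than 1, the exponential because its angle is half the difference of the
    arguments, in which the multiples of [2 pi] cancel. *)
Lemma binom_sums_half_clog p z z' : z' != 0 -> cabs (z - z') < cabs z' ->
  `|carg z - carg z'| < pi / 2 ->
  binom_sums (Defs.half R 1) ((z - z') / z') (cexp (Defs.half R 1 * (clog p z - clog p z'))).
Proof.
move=> z'0 hz hcarg; set w := _ / z'.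
have w1 : cabs w < 1 by rewrite cabsM cabsV ltr_pdivrMr ?cabs_gt0 // mul1r.
have z0 : z != 0 by apply: contraTneq hz => ->; rewrite sub0r cabsN ltxx.
have h2 : Defs.half R 1 = 2^-1 :> C by rewrite /Defs.half mul1r.
have wE : 1 + w = z / z' by rewrite /w mulrBl divff // addrC subrK.
rewrite h2; have [s Hs] := binom_sums_exists 2^-1 w1.
suff <- : s = cexp (2^-1 * (clog p z - clog p z')) by [].
apply: sqrt_unique.
- have H2 := binom_sumsD Hs Hs; rewrite -expr2 in H2.
  have H1 := binom_sums_nat 1 w.
  rewrite (_ : 2^-1 + 2^-1 = 1%:R :> C) in H2; last by field.
  rewrite (asum_unique H2 H1).
  rewrite expr1 wE -cexp_nat mulrA mulfV ?pnatr_eq0 // mul1r.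
  apply: (mulIf z'0); rewrite divfK // -{2}(cexp_clog p z'0) -cexpD subrK.
  by rewrite cexp_clog.
- have := le_lt_trans (Re_le_cabs _) (le_lt_trans (binom_sums_half_near1 w1 Hs) w1).
  by rewrite raddfB /= ltr_norml; case: (s) => a b /=; lra.
- rewrite /cexp (_ : complex.Im _ = (carg z - carg z') / 2).
    rewrite /= mul0r subr0 mulr_gt0 ?expR_gt0 // cos_gt0_pihalf //.
    by move: hcarg; rewrite ltr_norml; have := pi_gt0 R; lra.
  rewrite (_ : (2^-1 : C) = (2^-1 : R)%:C%C) /=; last by rewrite fmorphV rmorph_nat.
  by rewrite mul0r addr0; field.
Qed.

End Branches.

(** * Formal series and weak associativity *)

Section FormalSeries.
Variable F : numFieldType.
(* A formal series in z_0, z_1, ... is its family of coefficients, indexed by *)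
(* exponent functions. *)
Local Notation series := ((nat -> int) -> F).
Implicit Types (c : series) (e : nat -> int) (i n k : nat).

Definition mv e i (a : int) : nat -> int := fun k => e k + (if k == i then a else 0).

Ltac mv_lia := apply/funext => ?; rewrite /mv; do ?case: eqP; lia.

Lemma mvii e i a : mv e i a i = e i + a.
Proof. by rewrite /mv eqxx. Qed.

Lemma mvN e i a k : k != i -> mv e i a k = e k.
Proof. by rewrite /mv => /negbTE ->; rewrite addr0. Qed.

Lemma mvD e i a b : mv (mv e i a) i b = mv e i (a + b).
Proof. by apply/funext => k; rewrite /mv; case: eqP => _; rewrite ?addr0 ?addrA. Qed.

Lemma mvC e i j a b : mv (mv e i a) j b = mv (mv e j b) i a.
Proof. by apply/funext => k; rewrite /mv addrAC. Qed.

Lemma mv0 e i : mv e i 0 = e.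
Proof. by apply/funext => k; rewrite /mv; case: eqP; rewrite addr0. Qed.

(** A sum without convergence: all but finitely many terms vanish, as lower truncation ensures for
    each coefficient of an expansion. *)
Definition evsum (f : nat -> F) (s : F) :=
  exists J0, forall J, (J0 <= J)%N -> s = \sum_(j < J) f j.

Lemma eq_evsum (f g : nat -> F) s : f =1 g -> evsum f s -> evsum g s.
Proof. by move=> /funext ->. Qed.

Lemma evsum_unique (f : nat -> F) s t : evsum f s -> evsum f t -> s = t.
Proof.
move=> [J1 H1] [J2 H2]; rewrite (H1 (maxn J1 J2)) ?leq_maxl //.
by rewrite (H2 (maxn J1 J2)) ?leq_maxr.
Qed.

Lemma evsumD f g s t : evsum f s -> evsum g t -> evsum (fun j => f j + g j) (s + t).
Proof.
move=> [J1 H1] [J2 H2]; exists (maxn J1 J2) => J; rewrite geq_max => /andP[h1 h2].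
by rewrite big_split /= -H1 // -H2.
Qed.

Lemma evsumZ f s x : evsum f s -> evsum (fun j => x * f j) (x * s).
Proof. by move=> [J1 H1]; exists J1 => J /H1 ->; rewrite mulr_sumr. Qed.

Lemma evsum_shift (f : nat -> F) s : evsum f s ->
  evsum (fun j => if j is j'.+1 then f j' else 0) s.
Proof.
move=> [J1 H1]; exists J1.+1 => -[//|J]; rewrite ltnS => /H1 ->.
by rewrite big_ord_recl add0r.
Qed.

Lemma evsum_fin (f : nat -> F) K : (forall j, (K <= j)%N -> f j = 0) ->
  evsum f (\sum_(j < K) f j).
Proof.
move=> f0; exists K => J KJ; rewrite -!(big_mkord xpredT f) (@big_cat_nat _ _ _ K 0 J) //=.
by rewrite [X in _ + X]big_nat_cond [X in _ + X]big1 ?addr0 // => j /andP[/andP[/f0]].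
Qed.

Lemma evsum_one (f : nat -> F) j0 : (forall j, j != j0 -> f j = 0) -> evsum f (f j0).
Proof.
move=> f0; exists j0.+1 => J J0; rewrite (bigD1 (Ordinal J0)) //= big1 ?addr0 // => j ne.
by apply: f0; apply: contraNneq ne => h; apply/eqP/val_inj.
Qed.

Definition mulX k c : series := fun e => c (mv e k (-1)).
Definition mulXn k (p : nat) c : series := fun e => c (mv e k (- p%:Z)).

(* [translate i n c c']: c' is c with z_i replaced by z_i + z_n, expanded in      *)
(* nonnegative powers of z_n.                                                  *)
Definition translate i n c c' := forall e,
  evsum (fun j => gbinom ((e i + j%:Z)%:~R) j * c (mv (mv e i j%:Z) n (- j%:Z))) (c' e).

(* [binom_mul i n x p c c']: c' is z_n^(p-x) (z_n + z_i)^x c, expanded in         *)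
(* nonnegative powers of z_i.                                                  *)
Definition binom_mul i n (x : F) (p : nat) c c' := forall e,
  evsum (fun j => gbinom x j * c (mv (mv e i (- j%:Z)) n (j%:Z - p%:Z))) (c' e).

Lemma translateD i n c1 c1' c2 c2' : translate i n c1 c1' -> translate i n c2 c2' ->
  translate i n (fun e => c1 e + c2 e) (fun e => c1' e + c2' e).
Proof.
by move=> H1 H2 e; apply: eq_evsum (evsumD (H1 e) (H2 e)) => j; rewrite mulrDr.
Qed.

Lemma translateZ i n x c c' : translate i n c c' -> translate i n (fun e => x * c e) (fun e => x * c' e).
Proof. by move=> H e; apply: eq_evsum (evsumZ x (H e)) => j; rewrite mulrCA. Qed.

Lemma translate0 i n : translate i n (fun=> 0) (fun=> 0).
Proof. by move=> e; exists 0%N => J _; rewrite big1 // => j _; rewrite mulr0. Qed.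

Lemma translate_mulX i n k c c' : k != i -> translate i n c c' -> translate i n (mulX k c) (mulX k c').
Proof.
move=> ki H e; apply: eq_evsum (H (mv e k (-1))) => j.
by rewrite mvN 1?eq_sym // /mulX (mvC e) (mvC _ _ n).
Qed.

(** The factor [z_i] becomes [z_i + z_n]; on coefficients this is Pascal's rule. *)
Lemma translate_mulX_self i n c c' : i != n -> translate i n c c' ->
  translate i n (mulX i c) (fun e => mulX i c' e + mulX n c' e).
Proof.
move=> ni H e.
have H1 := H (mv e i (-1)); have H2 := evsum_shift (H (mv e n (-1))).
apply: eq_evsum (evsumD H1 H2) => -[|j] /=; rewrite /mulX mvii ?(mvN _ _ ni).
  rewrite addr0 !gbinom0; congr (_ * c _).
  mv_lia.
rewrite (_ : (e i + j.+1%:Z)%:~R = (e i + j%:Z)%:~R + 1 :> F); last first.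
  by rewrite -[j.+1]addn1 PoszD addrA rmorphD.
rewrite gbinom_Pascal mulrDl; congr (gbinom _ _ * c _ + gbinom _ _ * c _).
- by congr (_%:~R); lia.
- mv_lia.
- mv_lia.
Qed.

Lemma translate_unique i n c c1 c2 : translate i n c c1 -> translate i n c c2 -> c1 = c2.
Proof. by move=> H1 H2; apply/funext => e; apply: evsum_unique (H1 e) (H2 e). Qed.

Section TransFixed.
Variables (i n : nat) (x : F) (p : nat).

Lemma binom_mulD c1 c1' c2 c2' : binom_mul i n x p c1 c1' -> binom_mul i n x p c2 c2' ->
  binom_mul i n x p (fun e => c1 e + c2 e) (fun e => c1' e + c2' e).
Proof.
by move=> H1 H2 e; apply: eq_evsum (evsumD (H1 e) (H2 e)) => j; rewrite mulrDr.
Qed.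

Lemma binom_mulZ y c c' : binom_mul i n x p c c' -> binom_mul i n x p (fun e => y * c e) (fun e => y * c' e).
Proof. by move=> H e; apply: eq_evsum (evsumZ y (H e)) => j; rewrite mulrCA. Qed.

Lemma binom_mul0 : binom_mul i n x p (fun=> 0) (fun=> 0).
Proof. by move=> e; exists 0%N => J _; rewrite big1 // => j _; rewrite mulr0. Qed.

Lemma binom_mul_mulX k c c' : binom_mul i n x p c c' -> binom_mul i n x p (mulX k c) (mulX k c').
Proof.
move=> H e; apply: eq_evsum (H (mv e k (-1))) => j.
by rewrite /mulX (mvC e) (mvC _ _ n).
Qed.

End TransFixed.

(** Together with [translate_mulX_self], this allows the exponent [P] of weak associativity to be
    enlarged. *)
Lemma binom_mul_succ i n x p c c' : i != n -> binom_mul i n x p c c' ->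
  binom_mul i n (x + 1) p.+1 c (fun e => mulX i c' e + mulX n c' e).
Proof.
move=> ni H e.
have H1 := evsum_shift (H (mv e i (-1))); have H2 := H (mv e n (-1)).
apply: eq_evsum (evsumD H1 H2) => -[|j].
  rewrite add0r !gbinom0; congr (_ * c _).
  mv_lia.
rewrite gbinom_Pascal mulrDl addrC; congr (_ * c _ + _ * c _).
  mv_lia.
mv_lia.
Qed.

(** The bound is uniform in the exponent of [z_n], because cancelling a power of [z_i + z_n]
    compares coefficients with different exponents of [z_n]. *)
Definition bounded_below i n c := forall e, exists A0 : int, forall a b, a < A0 ->
  c (mv (mv e i a) n b) = 0.

Lemma bounded_below_mulX i n k c : bounded_below i n c -> bounded_below i n (mulX k c).
Proof.
move=> H e; have [A HA] := H (mv e k (-1)); exists A => a b aA.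
by rewrite /mulX (mvC _ n k) (mvC _ i k) HA.
Qed.

Lemma bounded_belowD i n c1 c2 : bounded_below i n c1 -> bounded_below i n c2 -> bounded_below i n (fun e => c1 e + c2 e).
Proof.
move=> H1 H2 e; have [A HA] := H1 e; have [B HB] := H2 e.
by exists (Num.min A B) => a b; rewrite lt_min => /andP[/HA -> /HB ->]; rewrite addr0.
Qed.

Lemma bounded_belowZ i n x c : bounded_below i n c -> bounded_below i n (fun e => x * c e).
Proof. by move=> H e; have [A HA] := H e; exists A => a b /HA ->; rewrite mulr0. Qed.

Lemma bounded_below0 i n : bounded_below i n (fun=> 0).
Proof. by move=> e; exists 0. Qed.

(** In the lowest power of [z_i] the product is the coefficient of [c] up to a power of [z_n];
    induction on the exponent of [z_i] then removes all coefficients. *)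
Lemma binom_mul_inj i n x p c : i != n -> bounded_below i n c -> binom_mul i n x p c (fun=> 0) -> c = fun=> 0.
Proof.
move=> ni Hl Ht; apply/funext => e; have [A0 HA] := Hl e.
have key k : forall a b, a < A0 + k%:Z -> c (mv (mv e i a) n b) = 0.
  elim: k => [|k IH] a b; first by rewrite addr0; exact: HA.
  move=> ak; have [J0 HJ] := Ht (mv (mv e i a) n (b + p%:Z)).
  have := HJ J0.+1 (leqnSn _); rewrite big_ord_recl big1 /=.
    rewrite gbinom0 mul1r addr0 oppr0 mv0 mvD => /esym.
    by rewrite (_ : b + _ + _ = b); last lia.
  move=> j _; rewrite (mvC _ n i) !mvD IH ?mulr0 // /bump /=; lia.
have := key (absz (A0 - 1)).+1 0 0; rewrite !mv0; apply; lia.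
Qed.

(* The expression of z_a at the stage where z_i, ..., z_(n-1) have been       *)
(* replaced by z_i + z_n, ..., z_(n-1) + z_n.                                 *)
Definition mulX_at i n a c : series := fun e =>
  mulX a c e + (if (i <= a < n)%N then 1 else 0) * mulX n c e.

Definition mul_diff_at i n (ab : nat * nat) c : series := fun e =>
  mulX_at i n ab.1 c e + (-1) * mulX_at i n ab.2 c e.

Definition mul_diffs_at i n (L : seq (nat * nat)) c : series := foldr (mul_diff_at i n) c L.

Lemma translate_mulX_at i n a c c' : (i < n)%N -> translate i n c c' ->
  translate i n (mulX_at i.+1 n a c) (mulX_at i n a c').
Proof.
move=> lin H; have ni : i != n by rewrite ltn_eqF.
rewrite /mulX_at; have [->|ai] := eqVneq a i.
  rewrite ltnn leqnn lin /=.
  have := translate_mulX_self ni H; congr translate; apply/funext => e; ring.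
rewrite [(i < a)%N]ltn_neqAle eq_sym ai /=.
apply: translateD; first exact: translate_mulX.
by apply: translateZ; apply: translate_mulX; rewrite 1?eq_sym.
Qed.

Lemma translate_mul_diffs_at i n L c c' : (i < n)%N -> translate i n c c' ->
  translate i n (mul_diffs_at i.+1 n L c) (mul_diffs_at i n L c').
Proof.
move=> lin H; elim: L => //= ab L IH.
by apply: translateD; [|apply: translateZ]; apply: translate_mulX_at.
Qed.

Lemma binom_mul_mul_diffs_at i0 i n x p L c c' : binom_mul i n x p c c' ->
  binom_mul i n x p (mul_diffs_at i0 n L c) (mul_diffs_at i0 n L c').
Proof.
move=> H; elim: L => //= ab L IH.
by apply: binom_mulD; [|apply: binom_mulZ]; apply: binom_mulD; [|apply: binom_mulZ | |apply: binom_mulZ]; apply: binom_mul_mulX.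
Qed.

Lemma bounded_below_mul_diffs_at i0 i n L c : bounded_below i n c -> bounded_below i n (mul_diffs_at i0 n L c).
Proof.
move=> H; elim: L => //= ab L IH.
by apply: bounded_belowD; [|apply: bounded_belowZ]; apply: bounded_belowD; [|apply: bounded_belowZ | |apply: bounded_belowZ]; apply: bounded_below_mulX.
Qed.

Lemma mul_diffs_at_mulXn i0 n L k p c : mul_diffs_at i0 n L (mulXn k p c) = mulXn k p (mul_diffs_at i0 n L c).
Proof.
elim: L => //= ab L ->; apply/funext => e; rewrite /mul_diff_at /mulX_at /mulXn /mulX.
by rewrite !(mvC e _ k).
Qed.

Variable hh : nat -> F.

Definition gbinomz (x : F) (m : int) := if m is Posz k then gbinom x k else 0.

(** For [j >= i] this is the coefficient of [z_j ^ e j] in the expansion of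
    [(z_j + z_n)^(bt j + hh j)]; for [j < i] the variable has not been replaced yet. *)
Definition mono_factor i (bt e : nat -> int) j :=
  if (j < i)%N then (e j == bt j)%:R else gbinomz ((bt j)%:~R + hh j) (e j).

(* The monomial bt at stage i.  The half-integral parts hh of the exponents   *)
(* of z_i, ..., z_n are not recorded in the exponent of z_n.                  *)
Definition mono i n (bt : nat -> int) : series := fun e =>
  (\prod_(j < n) mono_factor i bt e j) *
  (e n == bt n + \sum_(j < n | (i <= j)%N) (bt j - e j))%:R.

Definition laurent_coef_at i n (s : seq (F * (nat -> int))) : series := fun e =>
  \sum_(t <- s) t.1 * mono i n t.2 e.

Section MonomialStep.
Variables (i n : nat) (lin : (i < n)%N) (bt : nat -> int).
Let io := Ordinal lin.

Definition rfac e := \prod_(j < n | j != io) mono_factor i bt e j.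
Definition rexp e := bt n + \sum_(j < n | (i < j)%N) (bt j - e j).

Lemma rfac_mv e a b : rfac (mv (mv e i a) n b) = rfac e.
Proof.
apply: eq_bigr => j ji; rewrite /mono_factor.
have jn : (j : nat) != n by rewrite ltn_eqF.
by rewrite !mvN.
Qed.

Lemma rexp_mv e a b : rexp (mv (mv e i a) n b) = rexp e.
Proof.
rewrite /rexp; congr (_ + _); apply: eq_bigr => j ij.
have jn : (j : nat) != n by rewrite ltn_eqF.
by rewrite !mvN // gtn_eqF.
Qed.

Lemma monoS e : mono i.+1 n bt e = rfac e * (e i == bt i)%:R * (e n == rexp e)%:R.
Proof.
rewrite /mono (bigD1 io) //=; congr (_ * _); rewrite mulrC; congr (_ * _).
  apply: eq_bigr => j ji; rewrite /mono_factor ltnS leq_eqVlt.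
  by have -> : (j == i :> nat) = false by apply/negbTE; exact: ji.
by rewrite /mono_factor ltnSn.
Qed.

Lemma monoE e : mono i n bt e =
  rfac e * gbinomz ((bt i)%:~R + hh i) (e i) * (e n == rexp e + bt i - e i)%:R.
Proof.
rewrite /mono (bigD1 io) //=; congr (_ * _%:R).
  by rewrite mulrC /mono_factor ltnn.
congr (_ == _); rewrite (bigD1 io) //= /rexp.
rewrite (eq_bigl (fun j : 'I_n => (i < j)%N)); first by ring.
by move=> j; rewrite [(i < j)%N]ltn_neqAle andbC eq_sym.
Qed.

Lemma bounded_below_mono : bounded_below i n (mono i n bt).
Proof.
move=> e; have ni : i != n by rewrite ltn_eqF.
exists (- e i) => a b aA; rewrite monoE (mvN _ _ ni) mvii.
case E' : (e i + a) => [m|m] /=; last by rewrite mulr0 mul0r.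
by exfalso; lia.
Qed.

Variables (p d : nat).
Hypothesis pd : bt i + p%:Z = d%:Z.

(** The meeting point of the two sides for a monomial: once its exponent in [z_i] has been raised to
    a natural number [d], [(z_i + z_n)^d] is a polynomial, and both of its expansions agree. *)
Definition midstep e := rfac e * (gbinomz d%:R (e i) * (e n == rexp e + d%:Z - e i)%:R).

Lemma translate_mono : translate i n (mulXn i p (mono i.+1 n bt)) midstep.
Proof.
move=> e; have ni : i != n by rewrite ltn_eqF.
have ni' : n != i by rewrite eq_sym.
have E j : gbinom (e i + j%:Z)%:~R j * mulXn i p (mono i.+1 n bt) (mv (mv e i j%:Z) n (- j%:Z)) =
   rfac e * (((e i + j%:Z == d%:Z)%:R * (e n - j%:Z == rexp e)%:R) * gbinom d%:R j).
  rewrite /mulXn (mvC _ n i) mvD monoS rfac_mv rexp_mv (mvN _ _ ni) mvii (mvC _ i n) (mvN _ _ ni') mvii.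
  rewrite (_ : (e i + (j%:Z - p%:Z) == bt i) = (e i + j%:Z == d%:Z)); last by lia.
  case: (eqVneq (e i + j%:Z) d%:Z) => [->|_]; last by rewrite !(mulr0, mul0r).
  rewrite !mulr1 !mul1r mulrCA; congr (_ * _); rewrite mulrC; congr (_ * _).
apply: (eq_evsum (fun j => esym (E j))); apply: evsumZ.
case: (lerP (e i) d%:Z) => ed; last first.
  rewrite (_ : gbinomz _ _ = 0) ?mul0r.
    exists 0%N => J _; rewrite big1 // => j _.
    by rewrite (_ : (_ == d%:Z) = false) ?mul0r //; apply/negbTE; lia.
  by case: (e i) ed => k // kd; rewrite /= gbinom_nat bin_small.
(* Only [j = d - e i] contributes; the symmetry of binomial coefficients exchanges the expansions in
   [z_i] and in [z_n]. *)
pose j0 := `|(d%:Z - e i)%R|%N.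
have -> : gbinomz d%:R (e i) * (e n == rexp e + d%:Z - e i)%:R =
   (e i + j0%:Z == d%:Z)%:R * (e n - j0%:Z == rexp e)%:R * gbinom d%:R j0.
  rewrite (_ : (e i + j0%:Z == d%:Z) = true) ?mul1r; last by rewrite /j0; lia.
  rewrite [RHS]mulrC (_ : (e n - j0%:Z == _) = (e n == rexp e + d%:Z - e i)); last by rewrite /j0; lia.
  congr (_ * _); rewrite gbinom_nat; case: (e i) ed @j0 => k kd j0 /=.
    by rewrite gbinom_nat -bin_sub // /j0 (_ : `|_|%N = (d - k)%N) //; lia.
  by rewrite bin_small // /j0; lia.
apply: (@evsum_one (fun j => (e i + j%:Z == d%:Z)%:R * (e n - j%:Z == rexp e)%:R * gbinom d%:R j)).
move=> j jj0; rewrite (_ : (_ == d%:Z) = false) ?mul0r //; apply/negbTE.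
by apply: contraNneq jj0 => h; rewrite /j0; lia.
Qed.

Lemma binom_mul_mono x : x + ((bt i)%:~R + hh i) = d%:R ->
  binom_mul i n x p (mono i n bt) midstep.
Proof.
move=> xd e; have ni : i != n by rewrite ltn_eqF.
have ni' : n != i by rewrite eq_sym.
rewrite /midstep mulrA [_ * _ * _]mulrC mulrA.
set k0 := (_ * rfac e); set al := (bt i)%:~R + hh i in xd *.
have E j : gbinom x j * mono i n bt (mv (mv e i (- j%:Z)) n (j%:Z - p%:Z)) =
   k0 * (gbinom x j * gbinomz al (e i - j%:Z)).
  rewrite monoE rfac_mv rexp_mv (mvN _ _ ni) mvii (mvC _ i n) (mvN _ _ ni') mvii.
  have -> : (e n + (j%:Z - p%:Z) == rexp e + bt i - (e i - j%:Z)) = (e n == rexp e + d%:Z - e i).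
    by lia.
  rewrite /k0 /al; ring.
apply: (eq_evsum (fun j => esym (E j))); apply: evsumZ.
case: (e i) => k /=; last first.
  exists 0%N => J _; rewrite big1 // => j _.
  by case E' : (Negz k - _) => [m|m] /=; rewrite ?mulr0 //; exfalso; lia.
rewrite -xd addrC -gbinom_Vandermonde.
have -> : \sum_(j < k.+1) gbinom al (k - j) * gbinom x j =
   \sum_(j < k.+1) gbinom x j * gbinomz al (k%:Z - j%:Z).
  apply: eq_bigr => j _; have jk : (j <= k)%N by rewrite -ltnS.
  by rewrite subzn // mulrC.
apply: evsum_fin => j kj; case E' : (k%:Z - j%:Z) => [m|m] /=; rewrite ?mulr0 //.
by exfalso; lia.
Qed.

End MonomialStep.

Lemma bounded_below_laurent_coef_at i n s : (i < n)%N -> bounded_below i n (laurent_coef_at i n s).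
Proof.
move=> lin; rewrite /laurent_coef_at; elim: s => [|t s IH].
  by have := bounded_below0 i n; congr bounded_below; apply/funext => e; rewrite big_nil.
have := bounded_belowD (bounded_belowZ t.1 (bounded_below_mono lin t.2)) IH.
by congr bounded_below; apply/funext => e; rewrite big_cons.
Qed.

(** After multiplication by [(z_i + z_n)^(P + hh i)], both sides of the conclusion can be computed
    by translation from stage [i.+1], where they agree; [binom_mul_inj] cancels the factor. *)
Lemma stage_transfer i n L s c c' (par : nat) : (i < n)%N -> par%:R = hh i + hh i ->
  (exists P psi, translate i n (mulXn i (P + par) c') psi /\ binom_mul i n (P%:R + hh i) (P + par)%N c psi) ->
  bounded_below i n c -> mul_diffs_at i.+1 n L c' = laurent_coef_at i.+1 n s -> mul_diffs_at i n L c = laurent_coef_at i n s.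
Proof.
move=> lin parE [P0 [psi0 [HS0 HT0]]] cl cK.
have ni : i != n by rewrite ltn_eqF.
(* The exponent P may be enlarged, so that all exponents of z_i in s become nonnegative. *)
have [P [psi [HS HT HP]]] : exists (P : nat) psi, [/\ translate i n (mulXn i (P + par)%N c') psi,
     binom_mul i n (P%:R + hh i) (P + par)%N c psi &
     forall t, t \in map snd s -> 0 <= t i + (P + par)%:Z].
  pose D := (\sum_(t <- map snd s) `|t i|)%N.
  have HD (t : nat -> int) : t \in map snd s -> 0 <= t i + (P0 + D + par)%:Z.
    by move=> ts; rewrite /D (big_rem t) //=; lia.
  exists (P0 + D)%N; move: D HD => D HD.
  suff [psi [h1 h2]] : exists psi, translate i n (mulXn i (P0 + D + par)%N c') psi /\ binom_mul i n ((P0 + D)%:R + hh i) (P0 + D + par)%N c psi by exists psi.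
  clear HD; elim: D => [|D [psi [h1 h2]]]; first by exists psi0; rewrite addn0.
  exists (fun e => mulX i psi e + mulX n psi e); split.
    have := translate_mulX_self ni h1; congr translate; apply/funext => e.
    by rewrite /mulX /mulXn mvD; congr (c' (mv _ _ _)); lia.
  have := binom_mul_succ ni h2; rewrite (_ : _ + 1 = (P0 + D.+1)%:R + hh i).
    by rewrite addnS addSn.
  by rewrite addnS -natr1; ring.
pose p := (P + par)%N; rewrite -/p in HS HT HP.
have [Th [hTh1 hTh2]] : exists Th, translate i n (mulXn i p (laurent_coef_at i.+1 n s)) Th /\ binom_mul i n (P%:R + hh i) p (laurent_coef_at i n s) Th.
  rewrite /laurent_coef_at; elim: s HP {cK} => [|t s IH] HP.
    exists (fun=> 0); split.
      by have := translate0 i n; congr translate; apply/funext => e; rewrite /mulXn big_nil.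
    by have := binom_mul0 i n (P%:R + hh i) p; congr binom_mul; apply/funext => e; rewrite big_nil.
  have [|Th [h1 h2]] := IH; first by move=> t' t's; apply: HP; rewrite inE t's orbT.
  have pd : t.2 i + p%:Z = absz (t.2 i + p%:Z).
    by rewrite gez0_abs // HP // inE eqxx.
  (* The half in the exponent of weak associativity and the half carried by the monomial add up to
     the integer [par]. *)
  have xd : P%:R + hh i + ((t.2 i)%:~R + hh i) = (absz (t.2 i + p%:Z))%:R :> F.
    rewrite -[RHS]/((absz (t.2 i + p%:Z))%:Z%:~R : F) -pd rmorphD /= -[X in _ = _ + X]/(p%:R) /p natrD parE; ring.
  have g1 := translateZ t.1 (translate_mono lin pd); have g2 := binom_mulZ t.1 (binom_mul_mono lin pd xd).
  eexists; split.
    have := translateD g1 h1; congr translate; apply/funext => e.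
    by rewrite /mulXn big_cons.
  by have := binom_mulD g2 h2; congr binom_mul; apply/funext => e; rewrite big_cons.
(* Translation is single-valued and commutes with the factors, so the identity at stage [i.+1]
   determines the differences times [psi]. *)
have e1 : mul_diffs_at i n L psi = Th.
  apply: translate_unique hTh1; rewrite -cK -mul_diffs_at_mulXn; exact: translate_mul_diffs_at.
have e2 := binom_mulD (binom_mul_mul_diffs_at i L HT) (binom_mulZ (-1) hTh2).
have e3 : (fun e => mul_diffs_at i n L c e + -1 * laurent_coef_at i n s e) = fun=> 0.
  apply: (binom_mul_inj ni (x := P%:R + hh i) (p := p)).
    by apply: bounded_belowD; [exact: bounded_below_mul_diffs_at|apply: bounded_belowZ; exact: bounded_below_laurent_coef_at].
  move: e2; congr binom_mul; apply/funext => e; rewrite e1; ring.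
apply/funext => e; have := congr1 (@^~ e) e3; rewrite /= mulN1r => /eqP.
by rewrite subr_eq0 => /eqP.
Qed.

Lemma stages_transfer n L s (c : nat -> series) (par : nat -> nat) :
  (forall i, (i < n)%N -> (par i)%:R = hh i + hh i) ->
  (forall i, (i < n)%N -> exists (P : nat) psi, translate i n (mulXn i (P + par i)%N (c i.+1)) psi /\ binom_mul i n (P%:R + hh i) (P + par i)%N (c i) psi) ->
  (forall i, (i < n)%N -> bounded_below i n (c i)) ->
  mul_diffs_at n n L (c n) = laurent_coef_at n n s -> mul_diffs_at 0 n L (c 0%N) = laurent_coef_at 0 n s.
Proof.
move=> H1 H2 H3 H.
have key d : (d <= n)%N -> mul_diffs_at (n - d) n L (c (n - d)%N) = laurent_coef_at (n - d) n s.
  elim: d => [|d IH] dn; first by rewrite subn0.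
  have lin : (n - d.+1 < n)%N by lia.
  apply: (stage_transfer lin (H1 _ lin) (H2 _ lin) (H3 _ lin)).
  by rewrite -subSn // subSS IH // ltnW.
by have := key n (leqnn _); rewrite subnn.
Qed.

End FormalSeries.

(** * Laurent polynomials divided by products of differences *)

Section LaurentData.
Variable F : numFieldType.
Local Notation series := ((nat -> int) -> F).
Implicit Types (c : series) (e u : nat -> int) (L : seq (nat * nat)) (s : seq (F * (nat -> int))).

Definition mul_diffs L c : series :=
  foldr (fun ab c e => mulX ab.1 c e - mulX ab.2 c e) c L.

Definition laurent_coef n s : series := fun e =>
  \sum_(t <- s) t.1 * \prod_(j < n) (e j == t.2 j)%:R.

Definition diffs_val L (z : nat -> F) := \prod_(ab <- L) (z ab.1 - z ab.2).

Definition laurent_val n s (z : nat -> F) := \sum_(t <- s) t.1 * \prod_(j < n) z j ^ t.2 j.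

Lemma mul_diffs_at_n n L c : mul_diffs_at n n L c = mul_diffs L c.
Proof.
elim: L => //= ab L ->; apply/funext => e; rewrite /mul_diff_at /mulX_at.
have h x : (n <= x < n)%N = false by case: (leqP n x).
by rewrite !h !mul0r !addr0 mulN1r.
Qed.

Lemma laurent_coef_at_n hh n s : laurent_coef_at hh n n s = laurent_coef n.+1 s.
Proof.
apply/funext => e; apply: eq_bigr => t _; congr (_ * _).
rewrite /mono big_ord_recr /= [\sum_(_ < _ | _) _]big_pred0 ?addr0; last by move=> j; rewrite leqNgt ltn_ord.
by congr (_ * _); apply: eq_bigr => j _; rewrite /mono_factor ltn_ord.
Qed.

(* Once every z_a has become z_a + z_n, a factor z_a - z_n is the monomial    *)
(* z_a and a factor z_a - z_b with a, b < n does not involve z_n.             *)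
Definition add_poles n L e := foldr (fun ab e => if ab.2 == n then mv e ab.1 1 else e) e L.

Definition inner n L := [seq ab <- L | ab.2 != n].

Lemma add_poles_mv n L e k a : add_poles n L (mv e k a) = mv (add_poles n L e) k a.
Proof. by elim: L => //= ab L ->; case: ifP => // _; rewrite mvC. Qed.

Lemma mul_diffs_at0 n L c e : all (fun ab => (ab.1 < ab.2 <= n)%N) L ->
  mul_diffs_at 0 n L c (add_poles n L e) = mul_diffs (inner n L) c e.
Proof.
elim: L e => [|[a b] L IH] e //= /andP[/andP[ab bn] hL].
rewrite /mul_diff_at /mulX_at /=; have [->|bn'] := eqVneq b n.
  rewrite ltnn mul0r addr0 (leq_trans ab bn) mul1r mulN1r addrK.
  by rewrite /mulX mvD (_ : 1 + -1 = 0) // mv0 IH.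
have -> : (b < n)%N by rewrite ltn_neqAle bn' bn.
rewrite (leq_trans ab bn) !mul1r /= /mulX -!add_poles_mv !IH //; ring.
Qed.

(** The number of occurrences of [(j, n)] in [L], that is, the order of the pole along
    [z_j = z_n]. *)
Definition pole_order n L j : int := add_poles n L (fun=> 0) j.

Lemma add_polesE n L e j : add_poles n L e j = e j + pole_order n L j.
Proof.
rewrite /pole_order; elim: L => /= [|ab L IH]; first by rewrite addr0.
by case: ifP => // _; rewrite /mv IH addrA.
Qed.

Lemma pole_order_n n L : all (fun ab => (ab.1 < ab.2 <= n)%N) L -> pole_order n L n = 0.
Proof.
rewrite /pole_order; elim: L => //= -[a b] L IH /andP[/andP[ab bn] hL] /=.
by case: ifP => _; rewrite ?mvN ?IH // gtn_eqF // (leq_trans ab bn).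
Qed.

Lemma diffs_val_inner n L (z : nat -> F) : all (fun ab => (ab.1 < ab.2 <= n)%N) L ->
  (forall j, (j < n)%N -> z j - z n != 0) ->
  diffs_val L z = diffs_val (inner n L) (fun j => z j - z n) * \prod_(j < n) (z j - z n) ^ pole_order n L j.
Proof.
move=> hL z0; rewrite /diffs_val /pole_order; elim: L hL => [|[a b] L IH] /=.
  by move=> _; rewrite !big_nil mul1r big1 // => j _; rewrite expr0z.
move=> /andP[/andP[/= ab bn] hL]; rewrite big_cons IH //=.
have [->|bn'] := eqVneq b n.
  have an := leq_trans ab bn.
  rewrite /= mulrCA; congr (_ * _).
  rewrite (bigD1 (Ordinal an)) //= [RHS](bigD1 (Ordinal an)) //= mvii expfzDr ?z0 // expr1z.
  rewrite [in RHS](eq_bigr (fun j : 'I_n => (z j - z n) ^ add_poles n L (fun=> 0) j)).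
    by ring.
  by move=> j ja; rewrite mvN //.
by rewrite /= big_cons /= -mulrA; congr (_ * _); ring.
Qed.

(** Weak compositions of [k] into [n] parts; appending the last part matches a Cauchy product with
    one more series. *)
Fixpoint compositions n k : seq (seq nat) :=
  if n is n'.+1 then flatten [seq [seq rcons t j | t <- compositions n' (k - j)%N] | j <- iota 0 k.+1]
  else if k is 0 then [:: [::]] else [::].

Lemma compositionsS n k :
  compositions n.+1 k = flatten [seq [seq rcons t j | t <- compositions n (k - j)%N] | j <- iota 0 k.+1].
Proof. by []. Qed.

Lemma sum_compositions (G : zmodType) n k (f : seq nat -> G) :
  \sum_(t <- compositions n.+1 k) f t = \sum_(j < k.+1) \sum_(t <- compositions n (k - j)%N) f (rcons t j).
Proof.
rewrite compositionsS big_flatten big_map.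
rewrite -(big_mkord xpredT (fun j => \sum_(t <- compositions n (k - j)%N) f (rcons t j))).
by apply: eq_bigr => j _; rewrite big_map.
Qed.

Lemma size_compositions n k t : t \in compositions n k -> size t = n.
Proof.
elim: n k t => [[|k] t|n IH k t]; rewrite ?inE //; first by move/eqP ->.
by rewrite compositionsS => /flattenP[_ /mapP[j _ ->] /mapP[t' /IH h ->]]; rewrite size_rcons h.
Qed.

Definition compositionsz n (m : int) := if m is Posz k then compositions n k else [::].

(** At most one composition of [m] equals [e], and one does exactly when [e] is nonnegative of total
    degree [m]; the zero extension [gbinomz] and the last factor express this. *)
Lemma sum_compositionsz (al : nat -> F) n m (e : nat -> int) :
  \sum_(t <- compositionsz n m) (\prod_(j < n) gbinom (al j) (nth 0%N t j)) *
     \prod_(j < n) (e j == (nth 0%N t j)%:Z)%:R =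
  (\prod_(j < n) gbinomz (al j) (e j)) * (m == \sum_(j < n) e j)%:R.
Proof.
have neg n' m' : (exists2 j : 'I_n', e j < 0 & true) \/ \sum_(j < n') e j > m' ->
  (\prod_(j < n') gbinomz (al j) (e j)) * (m' == \sum_(j < n') e j)%:R = 0.
  move=> [[j ej _]|h]; last by rewrite lt_eqF // mulr0.
  rewrite (bigD1 j) //=; case: (e j) ej => // k _; by rewrite /= !mul0r.
elim: n m => [|n IH] m.
  rewrite !big_ord0; case: m => [[|k]|k] /=; rewrite ?big_nil ?mulr0 //.
  by rewrite big_seq1 !big_ord0.
case: m => k; last first.
  rewrite big_nil; apply/esym.
  have [/forallP h|] := boolP [forall j : 'I_n.+1, 0 <= e j].
    by apply: neg; right; apply: (@lt_le_trans _ _ 0) => //; apply: sumr_ge0.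
  by rewrite negb_forall => /existsP[j]; rewrite -ltNge => h; apply: neg; left; exists j.
rewrite [compositionsz _ _]/(compositions n.+1 k) sum_compositions.
have E (j : 'I_k.+1) : \sum_(t <- compositions n (k - j)%N) (\prod_(i < n.+1) gbinom (al i) (nth 0%N (rcons t j) i)) *
     \prod_(i < n.+1) (e i == (nth 0%N (rcons t j) i)%:Z)%:R =
   (gbinom (al n) j * (e n == j%:Z)%:R) *
   ((\prod_(i < n) gbinomz (al i) (e i)) * ((k - j)%N%:Z == \sum_(i < n) e i)%:R).
  rewrite -IH mulr_sumr /= big_seq [RHS]big_seq; apply: eq_bigr => t /size_compositions st.
  rewrite !big_ord_recr /= nth_rcons st ltnn eqxx.
  have nr (i : 'I_n) : nth 0%N (rcons t j) i = nth 0%N t i by rewrite nth_rcons st ltn_ord.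
  under eq_bigr do rewrite nr.
  have -> : \prod_(i < n) (e i == (nth 0%N (rcons t j) i)%:Z)%:R =
      \prod_(i < n) (e i == (nth 0%N t i)%:Z)%:R :> F by apply: eq_bigr => i _; rewrite nr.
  ring.
rewrite (eq_bigr _ (fun j _ => E j)) [in RHS]big_ord_recr [in RHS]big_ord_recr /=.
set A := \prod_(i < n) _; set Sg := \sum_(i < n) e i.
case en: (e n) => [l|l] /=; last first.
  by rewrite mulr0 mul0r big1 // => j _; rewrite mulr0 mul0r.
case: (leqP l k) => lk; last first.
  rewrite big1 => [|j _]; last first.
    rewrite (_ : (_ == _ :> int) = false) ?mulr0 ?mul0r //; apply/negbTE.
    by rewrite eqz_nat gtn_eqF // (leq_ltn_trans _ lk) // -ltnS.
  case: (ltP Sg 0) => hS; last first.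
    by rewrite (_ : (_ == _) = false) ?mulr0 //; apply/negbTE; lia.
  suff -> : A = 0 by rewrite !mul0r.
  have [/forallP h|] := boolP [forall j : 'I_n, 0 <= e j].
    have : 0 <= Sg by apply: sumr_ge0.
    by rewrite leNgt hS.
  rewrite negb_forall => /existsP[j]; rewrite -ltNge /A (bigD1 j) //=.
  by case: (e j) => // m _; rewrite mul0r.
have lk' : (l < k.+1)%N by [].
rewrite (bigD1 (Ordinal lk')) //= eqxx mulr1 big1 ?addr0 => [|j jl]; last first.
  rewrite (_ : (_ == _ :> int) = false) ?mulr0 ?mul0r //; apply: contraNF jl.
  by rewrite eqz_nat => /eqP h; apply/eqP/val_inj.
rewrite mulrCA mulrA; congr (_ * _%:R).
by apply/eqP/eqP; lia.
Qed.

Lemma sum_nth_compositions n k t : t \in compositions n k -> (\sum_(j < n) nth 0 t j)%N = k.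
Proof.
elim: n k t => [[|k] t|n IH k t]; rewrite ?big_ord0 ?inE //.
rewrite compositionsS => /flattenP[_ /mapP[j jk ->] /mapP[t' h ->]].
rewrite big_ord_recr /= nth_rcons (size_compositions h) ltnn eqxx.
rewrite (eq_bigr (fun j : 'I_n => nth 0%N t' j)) => [|i _].
  by rewrite (IH _ _ h) subnK //; move: jk; rewrite mem_iota.
by rewrite nth_rcons (size_compositions h) ltn_ord.
Qed.

(* The coefficient of z_n^b, as a Laurent polynomial in the z_j - z_n. *)
Definition innermono (hh : nat -> F) n L s (b : int) : seq (F * (nat -> int)) :=
  flatten [seq [seq (t.1 * \prod_(j < n) gbinom ((t.2 j)%:~R + hh j) (nth 0%N r j),
                     fun j => (nth 0%N r j)%:Z - pole_order n L j)
               | r <- compositionsz n (\sum_(j < n.+1) t.2 j - b)] | t : F * (nat -> int) <- s].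

(** Expanded monomials stay homogeneous, so the power [b] of [z_n] fixes the total degree in the
    other variables before the shift by the pole orders. Only finitely many terms remain. *)
Lemma laurent_coef_at0_innermono hh n L s e : all (fun ab => (ab.1 < ab.2 <= n)%N) L ->
  laurent_coef_at hh 0 n s (add_poles n L e) = laurent_coef n (innermono hh n L s (e n)) e.
Proof.
move=> hL; rewrite /laurent_coef_at /laurent_coef big_flatten big_map; apply: eq_bigr => t _.
rewrite big_map /mono add_polesE pole_order_n // addr0.
have -> : \prod_(j < n) mono_factor hh 0 t.2 (add_poles n L e) j =
    \prod_(j < n) gbinomz ((t.2 j)%:~R + hh j) (e j + pole_order n L j).
  by apply: eq_bigr => j _; rewrite /mono_factor /= add_polesE.
have -> : (e n == t.2 n + \sum_(j < n) (t.2 j - add_poles n L e j)) =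
    (\sum_(j < n.+1) t.2 j - e n == \sum_(j < n) (e j + pole_order n L j)).
  have h : \sum_(j < n) add_poles n L e j = \sum_(j < n) (e j + pole_order n L j).
    by apply: eq_bigr => j _; rewrite add_polesE.
  rewrite sumrB big_ord_recr /= h; set A := \sum_(i < n) t.2 i; set B := \sum_(j < n) _; lia.
rewrite -(sum_compositionsz (fun j => (t.2 j)%:~R + hh j) n _ (fun j => e j + pole_order n L j)) mulr_sumr.
apply: eq_bigr => r _; rewrite -mulrA; congr (_ * (_ * _)); apply: eq_bigr => j _.
by congr ((nat_of_bool _)%:R) => /=; lia.
Qed.

End LaurentData.

Section LaurentSums.
Variable R : realType.
Local Notation C := R[i].
Implicit Types (al w sg : nat -> C) (L : seq (nat * nat)).

(** An iterated Cauchy product of binomial series. Grouping by total degree is grouping by the power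
    of [z_n], the order in which the iterate is summed. *)
Lemma asum_compositions n al w sg : (forall j, (j < n)%N -> binom_sums (al j) (w j) (sg j)) ->
  asum (fun k => \sum_(t <- compositions n k) \prod_(j < n) (gbinom (al j) (nth 0%N t j) * w j ^+ nth 0%N t j))
    (\prod_(j < n) sg j).
Proof.
elim: n => [|n IH] H.
  have := asum_fin (t0 := [:: 0%N]) (a := fun k => \sum_(t <- compositions 0 k) \prod_(j < 0)
    (gbinom (al j) (nth 0%N t j) * w j ^+ nth 0%N t j)) isT.
  by rewrite !big_seq1 !big_ord0; apply => -[|k] //= _; rewrite big_nil.
rewrite big_ord_recr /=; have {}IH := IH (fun j jn => H j (ltnW jn)).
apply: eq_asum (asum_cauchy IH (H n (ltnSn n))) => k; rewrite sum_compositions.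
apply: eq_bigr => j _; rewrite mulr_suml big_seq [RHS]big_seq; apply: eq_bigr => t ht.
rewrite big_ord_recr /= nth_rcons (size_compositions ht) ltnn eqxx; congr (_ * _).
by apply: eq_bigr => i _; rewrite nth_rcons (size_compositions ht) ltn_ord.
Qed.

(** From [(u_j + z_n)^a = z_n^a (1 + u_j / z_n)^a] with [u_j = z_j - z_n]. The half-integral powers
    of [z_n] are left out, so [sg j] stands for [(z_j / z_n)^(hh j)]. *)
Lemma asum_innermono (hh : nat -> C) n L s (z sg : nat -> C) : z n != 0 ->
  all (fun ab => (ab.1 < ab.2 <= n)%N) L ->
  (forall j, (j < n)%N -> cabs (z j - z n) < cabs (z n) /\ z j - z n != 0) ->
  (forall j, (j < n)%N -> binom_sums (hh j) ((z j - z n) / z n) (sg j)) ->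
  asum (fun b => laurent_val n (innermono hh n L s b) (fun j => z j - z n) /
                 diffs_val (inner n L) (fun j => z j - z n) * z n ^ b)
    ((\prod_(j < n) sg j) * (laurent_val n.+1 s z / diffs_val L z)).
Proof.
move=> zn0 hL hz hsg; pose u j := z j - z n; pose w j := u j / z n.
have u0 j : (j < n)%N -> u j != 0 by move=> /hz[].
have w1 j : (j < n)%N -> cabs (w j) < 1.
  by move=> /hz[h _]; rewrite cabsM cabsV ltr_pdivrMr ?cabs_gt0 // mul1r.
have wE j : 1 + w j = z j / z n by rewrite /w /u mulrBl divff // addrC subrK.
rewrite (diffs_val_inner hL) //; set D := diffs_val _ _; set E := \prod_(j < n) (z j - z n) ^ _.
pose S (t : C * (nat -> int)) := \sum_(j < n.+1) t.2 j.
pose f (t : C * (nat -> int)) m := \sum_(r <- compositionsz n m)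
  (t.1 * \prod_(j < n) gbinom ((t.2 j)%:~R + hh j) (nth 0%N r j)) *
  \prod_(j < n) u j ^ ((nth 0%N r j)%:Z - pole_order n L j).
suff H t : asum (fun b => f t (S t - b) * z n ^ b)
   ((\prod_(j < n) sg j) * (t.1 * \prod_(j < n.+1) z j ^ t.2 j) / E).
  have := asumZ D^-1 (asum_sum s H); rewrite -mulr_suml -mulr_sumr invfM.
  rewrite (_ : D^-1 * _ = (\prod_(j < n) sg j) * (laurent_val n.+1 s z * (D^-1 * E^-1))); last first.
    rewrite /laurent_val; ring.
  apply: eq_asum => b; rewrite -mulr_suml mulrA; congr (_ * _); rewrite mulrC; congr (_ / _).
  by rewrite /laurent_val big_flatten big_map; apply: eq_bigr => t _; rewrite big_map.
have Hal j : (j < n)%N -> binom_sums ((t.2 j)%:~R + hh j) (w j) ((z j / z n) ^ t.2 j * sg j).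
  by move=> jn; apply: binom_sumsD (hsg _ jn); rewrite -wE; apply: binom_sums_int; exact: w1.
have := asumZ (z n ^ S t * t.1 / E) (asum_compositions (n := n) Hal).
have -> : z n ^ S t * t.1 / E * \prod_(j < n) ((z j / z n) ^ t.2 j * sg j) =
    (\prod_(j < n) sg j) * (t.1 * \prod_(j < n.+1) z j ^ t.2 j) / E.
  rewrite big_split /= (eq_bigr (fun j : 'I_n => z j ^ t.2 j * z n ^ (- t.2 j))); last first.
    by move=> j _; rewrite expfzMl exprz_inv.
  rewrite big_split /= big_ord_recr /=.
  have -> : z n ^ S t = z n ^ t.2 n * \prod_(j < n) z n ^ t.2 j.
    rewrite /S big_ord_recr /= addrC expfzDr //; congr (_ * _).
    by elim/big_rec2: _ => [|j x y _ <-]; rewrite ?expr0z // expfzDr.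
  have h (x : C) : x = x * ((\prod_(j < n) z n ^ t.2 j) * \prod_(j < n) z n ^ (- t.2 j)).
    by rewrite -big_split /= big1 ?mulr1 // => j _; rewrite -expfzDr // subrr.
  rewrite [RHS]h; ring.
(* The exponent of [z_n] is the total degree [S t] minus the degree [k] in the [u_j], hence at most
   [S t]. *)
move=> H; apply/(asum_reindex (f := fun k : nat => S t - k%:Z) (g := fun b => absz (S t - b)%R)).
- by move=> k; lia.
- move=> b hb; rewrite /f (_ : compositionsz n (S t - b) = [::]) ?big_nil ?mul0r //.
  by case E' : (S t - b) => [k|k] //; move: hb; lia.
apply: eq_asum H => k /=; rewrite (_ : S t - (S t - k%:Z) = k%:Z); last by lia.
rewrite /f /= mulr_sumr mulr_suml big_seq [RHS]big_seq; apply: eq_bigr => r hr.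
have -> : \prod_(j < n) (gbinom ((t.2 j)%:~R + hh j) (nth 0%N r j) * w j ^+ nth 0%N r j) =
    (\prod_(j < n) gbinom ((t.2 j)%:~R + hh j) (nth 0%N r j)) *
    ((\prod_(j < n) u j ^ (nth 0%N r j)%:Z) * \prod_(j < n) z n ^ (- (nth 0%N r j)%:Z)).
  rewrite -!big_split /=; apply: eq_bigr => j _; congr (_ * _).
  by rewrite exprnP /w expfzMl exprz_inv.
have -> : \prod_(j < n) u j ^ ((nth 0%N r j)%:Z - pole_order n L j) =
    (\prod_(j < n) u j ^ (nth 0%N r j)%:Z) * \prod_(j < n) u j ^ (- pole_order n L j).
  by rewrite -big_split /=; apply: eq_bigr => j _; rewrite expfzDr // u0.
rewrite expfzDr //.
have -> : \prod_(j < n) u j ^ (- pole_order n L j) = E^-1.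
  by rewrite -prodfV; apply: eq_bigr => j _; rewrite invr_expz.
have -> : \prod_(j < n) z n ^ (- (nth 0%N r j)%:Z) = z n ^ (- k%:Z).
  rewrite -(sum_nth_compositions hr) -[RHS]invr_expz -exprnP -prodrXr -prodfV.
  by apply: eq_bigr => j _; rewrite -invr_expz.
ring.
Qed.

End LaurentSums.

(** * Modes of a vertex algebra and of a twisted module *)

Section Gradings.
Variables (F : numFieldType) (V : lmodType F) (I : choiceType) (G : I -> set V).
Hypothesis HG : is_grading G.

Lemma grading_decomp x : exists (s : seq I) (u : I -> V),
  [/\ uniq s, forall i, G i (u i) & x = \sum_(i <- s) u i].
Proof.
have [G0 Gl Gd _] := HG; have [s [u [Gu ->]]] := Gd x.
(* The multiplicity of an index is absorbed into its component. *)
exists (undup s), (fun i => (count_mem i s)%:R *: u i); split; first exact: undup_uniq.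
  by move=> i; rewrite -[X in G i X]addr0; apply: Gl.
rewrite -big_undup_iterop_count; apply: eq_bigr => i _.
by rewrite scaler_nat.
Qed.

Variables (d : {linear V -> V}) (wt : I -> F).
Hypothesis dE : forall i x, G i x -> d x = wt i *: x.
Hypothesis wt_inj : injective wt.

(** The weight of a mode is accessible only through the commutator with [d]. An eigenvector of [d]
    has no component of another weight, hence is homogeneous. *)
Lemma grading_eigen mu x : d x = mu *: x -> x = 0 \/ exists2 i, wt i = mu & G i x.
Proof.
have [G0 Gl _ Gf] := HG; have [s [u [us Gu xE]]] := grading_decomp x.
move=> dx.
have sum0 : \sum_(i <- s) (wt i - mu) *: u i = 0.
  under eq_bigr do rewrite scalerBl.
  rewrite sumrB -scaler_sumr -xE -dx xE raddf_sum /=.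
  by rewrite -sumrB big1 // => i _; rewrite (dE (Gu i)) subrr.
have z i : i \in s -> wt i != mu -> u i = 0.
  move=> iis ne; have Gu' j : G j ((wt j - mu) *: u j).
    by rewrite -[X in G j X]addr0; apply: Gl.
  have /eqP := Gf s _ us Gu' sum0 i iis.
  by rewrite scaler_eq0 subr_eq0 (negbTE ne) /= => /eqP.
have [/hasP[i iis /eqP wi]|/hasPn h] := boolP (has (fun i => wt i == mu) s).
  right; exists i => //; rewrite xE (bigD1_seq i) //= big1_seq ?addr0 //.
  move=> j /andP[ji js]; apply: z => //; apply: contraNneq ji => wj.
  by apply/eqP/wt_inj; rewrite wj.
by left; rewrite xE big1_seq // => i /= iis; apply: z => //; exact: h.
Qed.

End Gradings.

Lemma fsbig_eventually (F : nmodType) (f : nat -> F) K J : (forall j, (K <= j)%N -> f j = 0) ->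
  (K <= J)%N -> \sum_(j \in [set: nat]) f j = \sum_(j < J) f j.
Proof.
move=> f0 KJ; rewrite -(big_mkord xpredT f) /index_iota subn0.
rewrite (@fsbig_seq _ _ _ _ _ f (iota_uniq 0 J)).
apply/esym/fsbig_widen => // j [_] /=.
by rewrite mem_iota add0n /= => /negP; rewrite -leqNgt => h; apply: f0; exact: leq_trans h.
Qed.

Lemma eventually0_sum (F : nmodType) (I : Type) (s : seq I) (f : I -> int -> F) :
  (forall i, exists M : int, forall m, M <= m -> f i m = 0) ->
  exists M : int, forall m, M <= m -> \sum_(i <- s) f i m = 0.
Proof.
move=> H; elim: s => [|i s [M HM]]; first by exists 0 => m _; rewrite big_nil.
have [M' HM'] := H i; exists (Num.max M M') => m; rewrite ge_max => /andP[h1 h2].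
by rewrite big_cons HM // HM' // addr0.
Qed.

Section LinearFacts.
Variables (F : nzRingType) (U : lmodType F) (W : lmodType F) (f : U -> W).
Hypothesis fl : linear f.

Lemma lin0 : f 0 = 0.
Proof. by have := fl (-1) 0 0; rewrite scaler0 addr0 scaleN1r addNr. Qed.

Lemma linZ a x : f (a *: x) = a *: f x.
Proof. by have := fl a x 0; rewrite !addr0 lin0 addr0. Qed.

Lemma linD x y : f (x + y) = f x + f y.
Proof. by have := fl 1 x y; rewrite !scale1r. Qed.

Lemma lin_sum (I : Type) (s : seq I) (g : I -> U) : f (\sum_(i <- s) g i) = \sum_(i <- s) f (g i).
Proof. by elim/big_rec2: _ => [|i y x _ <-]; [exact: lin0|exact: linD]. Qed.

End LinearFacts.

Section MosvaModes.
Variables (R : realType) (V : mosva R).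
Local Notation C := R[i].
Local Notation half := (Defs.half R).

Lemma half_addz a b : half (a + b) = half a + half b.
Proof. by rewrite /Defs.half rmorphD /= mulrDl. Qed.

Lemma half_inj : injective half.
Proof.
have n2 : (2%:R : C)^-1 != 0 by rewrite invr_eq0 pnatr_eq0.
by move=> a b /(mulIf n2) /intr_inj.
Qed.

Lemma half_double a : half (2 * a) = a%:~R.
Proof.
have n2 : (2%:R : C) != 0 by rewrite pnatr_eq0.
by rewrite /Defs.half rmorphM /= mulrAC mulfV // mul1r.
Qed.

Lemma mosva_gr_eigen k (x : V) : mosva_d V x = half k *: x -> mosva_gr k x.
Proof.
move=> h; have [G0 _ _ _] := mosva_grading V.
have [->|[i /half_inj <-]] := grading_eigen (mosva_grading V) (@mosva_dE _ V) half_inj h; first exact: G0.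
by [].
Qed.

Lemma mosva_Y_gr k l (u x : V) m : mosva_gr k u -> mosva_gr l x ->
  mosva_gr (k + l - 2 * m - 2) ((mosva_Y u m x : V)).
Proof.
move=> gu gx; apply: mosva_gr_eigen.
have /eqP := mosva_d_comm u m x; rewrite (mosva_dE gu) (mosva_dE gx) linearZ /=.
rewrite (linZ (mosva_Y_linear m x)) subr_eq => /eqP ->.
rewrite -!scalerDl; congr (_ *: _).
by rewrite -half_double -!half_addz; congr half; ring.
Qed.

(** Lower truncation follows from the grading: the weight of [u_m x] decreases as [m] grows, and
    weights are bounded below. *)
Lemma mosva_trunc (u x : V) : exists M : int, forall m, M <= m -> (mosva_Y u m x : V) = 0.
Proof.
have [N HN] := mosva_lower V.
have [s [us [_ gu ->]]] := grading_decomp (mosva_grading V) u.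
have [t [xs [_ gx ->]]] := grading_decomp (mosva_grading V) x.
have [i|M HM] := @eventually0_sum _ _ s (fun i m => mosva_Y (us i) m (\sum_(j <- t) xs j)).
  have [j|M HM] := @eventually0_sum _ _ t (fun j m => mosva_Y (us i) m (xs j)).
    exists (`|i + j - N| + 1) => m hm; apply: HN (mosva_Y_gr m (gu i) (gx j)); lia.
  by exists M => m /HM; rewrite raddf_sum.
by exists M => m /HM; rewrite -(lin_sum (mosva_Y_linear m _)).
Qed.

(** The coefficient of [x_0 ^ a x_2 ^ (b / 2)]. The power of [x_2] given by the parity of the second
    vector is divided out, so [y] may be inhomogeneous. *)
Definition wa_lhs (W : lmodType C) (Y : V -> int -> W -> W) (P p : nat) (v y : V) (w : W) (a b : int) (j : nat) : W :=
  gbinom ((a + j%:Z)%:~R : C) j *: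
    Y v (2 * P%:Z + p%:Z - 2 - 2 * j%:Z - 2 * a) (Y y (2 * j%:Z - 2 - b) w).

Definition wa_rhs (W : lmodType C) (Y : V -> int -> W -> W) (P p : nat) (v y : V) (w : W) (a b : int) (j : nat) : W :=
  gbinom (P%:R + half p : C) j *:
    Y (mosva_Y v (j%:Z - 1 - a) y) (2 * P%:Z + p%:Z - 2 - 2 * j%:Z - b) w.

(* Modes are indexed by doubled half-integers, and p is the parity of v. *)
Definition weak_assoc (W : lmodType C) (Y : V -> int -> W -> W) (p : nat) (v : V) (w : W) :=
  exists P : nat, forall y a b, exists (x : W) (J0 : nat), forall J, (J0 <= J)%N ->
    x = \sum_(j < J) wa_lhs Y P p v y w a b j /\ x = \sum_(j < J) wa_rhs Y P p v y w a b j.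

(** With doubled indices, [V] acting on itself and [W] are treated alike. An odd index repeats a
    mode instead of giving 0; weak associativity survives because, within one identity, the indices
    that involve [b] all have its parity. *)
Definition mosva_Y2 (u : V) (m : int) (x : V) : V := mosva_Y u (m %/ 2)%Z x.

Lemma mosva_weak_assoc (v w : V) : weak_assoc mosva_Y2 0 v w.
Proof.
have [P HP] := mosva_assoc v w; exists P => y a b.
(* The ceiling of [b / 2]: rounding the indices down rounds [b] up. *)
pose b' := - ((- b) %/ 2)%Z.
have [M1 H1] := mosva_trunc y w; have [M2 H2] := mosva_trunc v y.
pose K := absz (`|M1| + `|M2| + `|a| + `|b'| + 2)%R.
have L j : wa_lhs mosva_Y2 P 0 v y w a b j = gbinom ((a + j%:Z)%:~R : C) j *:
   mosva_Y v (P%:Z - 1 - j%:Z - a) (mosva_Y y (j%:Z - 1 - b') w).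
  rewrite /wa_lhs /mosva_Y2 (_ : (_ %/ 2)%Z = P%:Z - 1 - j%:Z - a); last by lia.
  by rewrite (_ : (_ %/ 2)%Z = j%:Z - 1 - b') //; rewrite /b'; lia.
have Rr j : wa_rhs mosva_Y2 P 0 v y w a b j = gbinom (P%:R : C) j *:
   mosva_Y (mosva_Y v (j%:Z - 1 - a) y) (P%:Z - 1 - j%:Z - b') w.
  rewrite /wa_rhs /mosva_Y2 (_ : (_ %/ 2)%Z = P%:Z - 1 - j%:Z - b'); last by rewrite /b'; lia.
  by rewrite /Defs.half mul0r addr0.
have := HP y a b'; rewrite (@fsbig_eventually _ _ K K) //; last first.
  by move=> j Kj; rewrite H1 ?raddf0 ?scaler0 //; rewrite /K in Kj; lia.
move=> E; exists (\sum_(j < K) wa_lhs mosva_Y2 P 0 v y w a b j), K => J KJ.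
have {}E : \sum_(j < K) wa_lhs mosva_Y2 P 0 v y w a b j = 
   \sum_(j \in [set: nat]) wa_rhs mosva_Y2 P 0 v y w a b j.
  under eq_bigr do rewrite L.
  by rewrite E; apply: eq_fsbigr => j _; rewrite Rr.
split.
  by rewrite -!(@fsbig_eventually _ _ K) // => j Kj;
    rewrite L H1 ?raddf0 ?scaler0 //; rewrite /K in Kj; lia.
rewrite E (@fsbig_eventually _ _ K J) // => j Kj.
rewrite Rr H2; first by rewrite (lin0 (mosva_Y_linear _ _)) scaler0.
by rewrite /K in Kj; lia.
Qed.

End MosvaModes.

Section TwistedModes.
Variables (R : realType) (V : mosva R) (theta : involution V) (W : twisted_module theta).
Local Notation C := R[i].
Local Notation half := (Defs.half R).

Lemma tw_trunc (u : V) (x : W) : exists M : int, forall m, M <= m -> tw_Y W u m x = 0.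
Proof.
have [N HN] := @tw_lower _ _ _ W.
have [s [us [_ gu ->]]] := grading_decomp (mosva_grading V) u.
have [t [xs [_ gx ->]]] := grading_decomp (@tw_grading _ _ _ W) x.
have [i|M HM] := @eventually0_sum _ _ s (fun i m => tw_Y W (us i) m (\sum_(j <- t) xs j)).
  have [j|M HM] := @eventually0_sum _ _ t (fun j m => tw_Y W (us i) m (xs j)).
    pose B := Num.bound (`|complex.Re j| + `|N|).
    have hB : `|complex.Re j| + `|N| < B%:R by apply: archi_boundP; rewrite addr_ge0.
    exists (`|i| + 2 * B%:Z) => m hm.
    have E : tw_d W (tw_Y W (us i) m (xs j)) = (half i + j + half (- m - 2)) *: tw_Y W (us i) m (xs j).
      have /eqP := tw_d_comm (us i) m (xs j).
      rewrite (mosva_dE (gu i)) (tw_dE (gx j)) linearZ /= (linZ (tw_Y_linear m _)) subr_eq => /eqP ->.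
      by do 2!rewrite -scalerDl; rewrite addrAC.
    have [//|[c cE gc]] := grading_eigen (@tw_grading _ _ _ W) (wt := id) (@tw_dE _ _ _ W) (fun _ _ h => h) E.
    apply: HN gc; rewrite cE (_ : complex.Re _ = complex.Re j + (i - m - 2)%:~R / 2); last first.
      rewrite addrAC -half_addz addrA /Defs.half (_ : (_%:~R / 2%:R : C) = ((i - m - 2)%:~R / 2 : R)%:C%C).
        by rewrite addrC; case: (j) => ? ?.
      by rewrite rmorphM /= fmorphV /= rmorph_nat rmorph_int.
    have h1 : (i - m - 2)%:~R <= (- (2 * B%:Z))%:~R :> R by rewrite ler_int; lia.
    rewrite mulrNz rmorphM /= -[(Posz B)%:~R]/(B%:R) in h1.
    have := ler_norm (complex.Re j); have := ler_norm (- N); rewrite normrN; lra.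
  by exists M => m /HM; rewrite raddf_sum.
by exists M => m /HM; rewrite -(lin_sum (tw_Y_linear m _)).
Qed.

Lemma par_lt2 k : (par k < 2)%N.
Proof. by rewrite /par; case: odd. Qed.

(** [P] is chosen before [y], so the identities for the homogeneous components of [y] can be
    added. *)
Lemma weak_assoc_decomp (p : nat) (v : V) (w : W) (P : nat) :
  (forall k y, mosva_gr k y -> forall a b, exists (x : W) (J0 : nat), forall J, (J0 <= J)%N ->
     x = \sum_(j < J) wa_lhs (tw_Y W) P p v y w a b j /\
     x = \sum_(j < J) wa_rhs (tw_Y W) P p v y w a b j) ->
  weak_assoc (tw_Y W) p v w.
Proof.
move=> H; exists P => y a b.
have [s [ys [_ gy ->]]] := grading_decomp (mosva_grading V) y.
elim: s => [|k s [x [J0 IH]]].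
  exists 0, 0%N => J _; rewrite big_nil; split; rewrite big1 // => j _.
    by rewrite /wa_lhs (lin0 (tw_Y_linear _ _)) raddf0 scaler0.
  by rewrite /wa_rhs raddf0 (lin0 (tw_Y_linear _ _)) scaler0.
have [x' [J0' Hk]] := H k _ (gy k) a b.
exists (x' + x), (maxn J0' J0) => J; rewrite geq_max => /andP[/Hk[h1 h2] /IH[h3 h4]].
rewrite big_cons; split.
  rewrite h1 h3 -big_split /=; apply: eq_bigr => j _.
  by rewrite /wa_lhs (linD (tw_Y_linear _ _)) [tw_Y W v _ (_ + _)]linearD scalerDr.
rewrite h2 h4 -big_split /=; apply: eq_bigr => j _.
by rewrite /wa_rhs [mosva_Y v _ (_ + _)]linearD (linD (tw_Y_linear _ _)) scalerDr.
Qed.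

Lemma tw_weak_assoc k (v : V) (w : W) : mosva_gr k v -> weak_assoc (tw_Y W) (par k) v w.
Proof.
move=> gv; have [P HP] := tw_assoc w gv.
apply: (@weak_assoc_decomp _ _ _ P) => l y gy a b.
have [_ _ HE] := HP l y gy.
have [M1 H1] := tw_trunc y w; have [M2 H2] := mosva_trunc v y.
pose K := absz (`|M1| + `|M2| + `|a| + `|b| + 2)%R.
have := HE (2 * a) (b + (par l)%:Z); rewrite /tw_assoc_lhs /tw_assoc_rhs.
have -> : odd (absz (2 * a)) = false by rewrite abszM oddM.
have -> : ((2 * a) %/ 2)%Z = a by lia.
rewrite (eq_fsbigr (fun j => wa_lhs (tw_Y W) P (par k) v y w a b j)); last first.
  move=> j _; rewrite /wa_lhs half_double rmorphD /=.
  by rewrite (_ : 2 * j%:Z + (par l)%:Z - 2 - (b + (par l)%:Z) = 2 * j%:Z - 2 - b) //; ring.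
rewrite [X in _ = X -> _](eq_fsbigr (fun j => wa_rhs (tw_Y W) P (par k) v y w a b j)); last first.
  move=> j _; rewrite /wa_rhs.
  rewrite (_ : _ - (b + (par l)%:Z) = 2 * P%:Z + (par k)%:Z - 2 - 2 * j%:Z - b) //; ring.
move=> E.
have L j : (K <= j)%N -> wa_lhs (tw_Y W) P (par k) v y w a b j = 0.
  by move=> Kj; rewrite /wa_lhs H1 ?raddf0 ?scaler0 //; rewrite /K in Kj; lia.
have Rr j : (K <= j)%N -> wa_rhs (tw_Y W) P (par k) v y w a b j = 0.
  move=> Kj; rewrite /wa_rhs H2; first by rewrite (lin0 (tw_Y_linear _ _)) scaler0.
  by rewrite /K in Kj; lia.
exists (\sum_(j \in [set: nat]) wa_lhs (tw_Y W) P (par k) v y w a b j), K => J KJ.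
split; [exact: (fsbig_eventually L KJ)|rewrite E; exact: (fsbig_eventually Rr KJ)].
Qed.

(** The commutator of [d] with the mode of index -1 of the vacuum, applied to the vacuum, gives
    [d 1 = 0]. *)
Lemma mosva_one_gr : mosva_gr 0 (mosva_one V).
Proof.
apply: mosva_gr_eigen.
have := mosva_d_comm (mosva_one V) (-1) (mosva_one V).
rewrite !mosva_one_l eqxx subrr opprK subrr scale0r addr0 mosva_creation_cst => <-.
by rewrite /Defs.half mul0r scale0r.
Qed.

(** With the vacuum as second vector, the left side of weak associativity has at [B = 0] the single
    term [v_m w]; it belongs to a series in [W((x_0, x_2))], where odd doubled exponents do not
    occur. *)
Lemma tw_parity k (v : V) (w : W) m : mosva_gr k v -> odd (absz (m - (par k)%:Z)) ->
  tw_Y W v m w = 0.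
Proof.
move=> gv om; have [P HP] := tw_assoc w gv; have [[N HN] _ _] := HP 0 _ mosva_one_gr.
apply: contraTeq om => nat_points.
pose A := 2 * P%:Z + (par k)%:Z - 2 - m.
have [] := HN A 0.
  rewrite /tw_assoc_lhs (@fsbig_eventually _ _ 1 1) //.
    rewrite big_ord1 tw_one /= gbinom0 scale1r.
    by rewrite (_ : _ - A = m) // /A /=; lia.
  move=> j j1; rewrite tw_one (_ : (_ == -2) = false) ?raddf0 ?scaler0 //.
  by apply/negbTE; rewrite /par /=; lia.
by move=> oA _ _ _; move: oA; rewrite /A; lia.
Qed.

End TwistedModes.

(** * Iterates *)

Section IteratedSums.
Variable R : realType.
Local Notation C := R[i].

Definition upd (N : nat -> int) d m : nat -> int := fun k => if k == d then m else N k.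

(** Exponents are indexed by [nat], so that induction on the number of variables stays within one
    type. *)
Fixpoint nat_iter_sums d (a : (nat -> int) -> C) (s : C) : Prop :=
  if d is d'.+1 then exists b : int -> C,
    (forall m, nat_iter_sums d' (fun N => a (upd N d' m)) (b m)) /\ asum b s
  else a (fun=> 0) = s.

Lemma eq_nat_iter_sums d a a' s : a =1 a' -> nat_iter_sums d a s -> nat_iter_sums d a' s.
Proof. by move=> /funext ->. Qed.

Lemma nat_iter_sumsZ d a s k : nat_iter_sums d a s -> nat_iter_sums d (fun N => k * a N) (k * s).
Proof.
elim: d a s => [|d IH] a s /=; first by move=> ->.
move=> [b [Hb Hs]]; exists (fun m => k * b m); split; last exact: asumZ.
by move=> m; exact: IH.
Qed.

Lemma nat_iter_sums0 d : nat_iter_sums d (fun=> 0) 0.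
Proof.
elim: d => [|d IH] //=; exists (fun=> 0); split=> [_|]; [exact: IH|exact: asum0].
Qed.

(* The last point is followed by 0. *)
Definition xd n (u : nat -> C) i := if (i.+1 < n)%N then u i - u i.+1 else u i.

(** The region of the iterate without the condition on arguments. Passing from [z] to the
    differences [z_j - z_n] preserves this form. *)
Definition nested n (u : nat -> C) :=
  (forall i j, (j < i < n)%N -> cabs (u j - u i) < cabs (xd n u i) /\ 0 < cabs (u j - u i)) /\
  ((0 < n)%N -> u n.-1 != 0).

Lemma nested_last n z : nested n.+1 z -> z n != 0 /\
  forall j, (j < n)%N -> cabs (z j - z n) < cabs (z n) /\ z j - z n != 0.
Proof.
move=> [H1 H2]; split=> [|j jn]; first exact: H2.
have [] := H1 n j; first by rewrite jn ltnSn.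
by rewrite /xd ltnn cabs_gt0.
Qed.

Lemma xd_sub n z i : (i < n)%N -> xd n (fun j => z j - z n) i = xd n.+1 z i.
Proof.
move=> lin; rewrite /xd ltnS lin; case: ltnP => h; first by ring.
by have -> : n = i.+1 by apply/eqP; rewrite eqn_leq h lin.
Qed.

Lemma nested_sub n z : nested n.+1 z -> nested n (fun j => z j - z n).
Proof.
move=> Hr; have [z0 hz] := nested_last Hr; have [H1 _] := Hr; split.
  move=> i j /andP[ji lin]; rewrite xd_sub //= (_ : _ - _ - _ = z j - z i); last by ring.
  by apply: H1; rewrite ji ltnS ltnW.
by case: n z Hr z0 hz H1 => // n z _ _ hz _ _; have [] := hz n (ltnSn n).
Qed.

End IteratedSums.

Section Iterates.
Variables (R : realType) (V : mosva R).
Local Notation C := R[i].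
Local Notation half := (Defs.half R).
Implicit Types (v : nat -> V) (e N : nat -> int).

Definition prodV v i n e : V :=
  foldr (fun j x => mosva_Y (v j) (- e j - 1) x) (v n) (iota i (n - i)).

Fixpoint iterV v N n : V :=
  if n is n'.+1 then mosva_Y (iterV v N n') (N n') (v n) else v 0%N.

Lemma iterV_upd v N n d m : (n <= d)%N -> iterV v (upd N d m) n = iterV v N n.
Proof.
elim: n => //= n IH nd; rewrite IH; last exact: ltnW.
by rewrite /upd ltn_eqF.
Qed.

Lemma prodV_step v i n e : (i < n)%N ->
  prodV v i n e = mosva_Y (v i) (- e i - 1) (prodV v i.+1 n e).
Proof. by move=> lin; rewrite /prodV -subnSK. Qed.

Lemma prodV_mv v i n e k a : ~~ (i <= k < n)%N -> prodV v i n (mv e k a) = prodV v i n e.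
Proof.
move=> h; rewrite /prodV; have : all (fun j => j != k) (iota i (n - i)).
  apply/allP => j; rewrite mem_iota => hj; apply: contraNneq h => <-.
  by case: (leqP i n) hj; lia.
by elim: (iota _ _) => //= j l IH /andP[jk /IH ->]; rewrite mvN.
Qed.

(** The hypothesis on [lam] is a formal identity, since no convergence of products is known below
    the outermost level. *)
Definition iterates_converge n := forall v (lam : V -> C) (L : seq (nat * nat)) (s : seq (C * (nat -> int))) u,
  linear (lam : V -> C^o) -> all (fun ab => (ab.1 < ab.2 < n)%N) L ->
  mul_diffs L (fun e => lam (prodV v 0 n e)) = laurent_coef n s -> nested n u ->
  nat_iter_sums n (fun N => lam (iterV v N n) * \prod_(i < n) xd n u i ^ (- N i - 1))
    (laurent_val n s u / diffs_val L u).

(** * One level of the iterate: operators moved inside the last one *)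

Section Step.
Variables (W : lmodType C) (Y : V -> int -> W -> W).
Hypothesis Yl : forall m x, linear (fun u => Y u m x).
Hypothesis Yr : forall u m, linear (Y u m).
Variables (par : nat -> nat) (v : nat -> V) (w : W) (lam : W -> C) (n : nat).
Hypothesis laml : linear (lam : W -> C^o).
Hypothesis Ywa : forall i, (i < n)%N -> weak_assoc Y (par i) (v i) w.

Definition outer_modes i e (x : W) : W :=
  foldr (fun j x => Y (v j) (- 2 * e j - 2 - (par j)%:Z) x) x (iota 0 i).

Lemma outer_linear i e : linear (outer_modes i e).
Proof. by move=> a x y; rewrite /outer_modes; elim: (iota 0 i) => //= j l ->; rewrite Yr. Qed.

Lemma lam_outer_linear i e : linear ((fun x => lam (outer_modes i e x)) : W -> C^o).
Proof. by move=> a x y; rewrite outer_linear laml. Qed.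

Lemma outer_step i e x :
  outer_modes i.+1 e x = outer_modes i e (Y (v i) (- 2 * e i - 2 - (par i)%:Z) x).
Proof. by rewrite /outer_modes -(addn1 i) iotaD foldr_cat. Qed.

Lemma outer_mv i e k a x : (i <= k)%N -> outer_modes i (mv e k a) x = outer_modes i e x.
Proof.
move=> ik; rewrite /outer_modes; have : all (fun j => j != k) (iota 0 i).
  by apply/allP => j; rewrite mem_iota add0n => /= ji; rewrite ltn_eqF // (leq_trans ji).
by elim: (iota 0 i) => //= j l IH /andP[jk /IH ->]; rewrite mvN.
Qed.

Definition parsum i : int := \sum_(i <= j < n.+1) (par j)%:Z.

Lemma parsum_step i : (i < n)%N -> parsum i = (par i)%:Z + parsum i.+1.
Proof. by move=> lin; rewrite /parsum big_ltn // ltnW. Qed.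

Lemma outer_last e : outer_modes n.+1 e w =
  outer_modes n e (Y (prodV v n n e) (- 2 * e n - 2 - parsum n) w).
Proof. by rewrite outer_step /prodV subnn /parsum big_nat1. Qed.

(* The operators v_i, ..., v_(n-1) have been moved inside the last one.  The   *)
(* exponent of z_j is e j + par j / 2 for j < i, and e n + parsum i / 2 for    *)
(* j = n.                                                                      *)
Definition stage i e : C :=
  lam (outer_modes i e (Y (prodV v i n e) (- 2 * e n - 2 - parsum i) w)).

Lemma stage_bounded_below i : (i < n)%N -> bounded_below i n (stage i).
Proof.
move=> lin e; have [M HM] := mosva_trunc (v i) (prodV v i.+1 n e).
exists (- e i - 1 - M) => a b ha; have ni : i != n by rewrite ltn_eqF.
rewrite /stage !outer_mv // ?(ltnW lin) // prodV_mv; last by rewrite ltnn andbF.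
rewrite prodV_step // (mvii e i) prodV_mv; last by rewrite ltnn.
rewrite HM; last by lia.
by rewrite (lin0 (Yl _ _)) (lin0 (lam_outer_linear i e)).
Qed.

Lemma stage_trans i : (i < n)%N -> exists (P : nat) psi,
  translate i n (mulXn i (P + par i)%N (stage i.+1)) psi /\
  binom_mul i n (P%:R + half (par i)) (P + par i)%N (stage i) psi.
Proof.
move=> lin; have ni : i != n by rewrite ltn_eqF.
have [P HP] := Ywa lin; exists P.
(* The same [P] serves every [e], so the common values of weak associativity form one coefficient
   family. *)
have [x Hx] := choice (fun e => HP (prodV v i.+1 n e) (e i) (2 * e n + parsum i.+1)).
have lsum e (f : nat -> W) J : lam (outer_modes i e (\sum_(j < J) f j)) = \sum_(j < J) lam (outer_modes i e (f j)).
  exact: (lin_sum (lam_outer_linear i e)).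
have lZ e a y : lam (outer_modes i e (a *: y)) = a * lam (outer_modes i e y).
  exact: (linZ (lam_outer_linear i e)).
exists (fun e => lam (outer_modes i e (x e))); split=> e; have [J0 HJ] := Hx e; exists J0 => J /HJ[h1 h2].
  rewrite h1 lsum; apply: eq_bigr => j _; rewrite /wa_lhs lZ; congr (_ * _).
  rewrite /mulXn /stage outer_step !outer_mv // ?(ltnW lin) // !prodV_mv ?ltnn ?andbF //.
  congr (lam (outer_modes _ _ (Y _ _ (Y _ _ _)))).
    by rewrite /mv eqxx (negbTE ni); lia.
  by rewrite /mv eqxx [n == i]eq_sym (negbTE ni); lia.
rewrite h2 lsum; apply: eq_bigr => j _; rewrite /wa_rhs lZ; congr (_ * _).
rewrite /stage !outer_mv // ?(ltnW lin) // prodV_mv ?ltnn ?andbF //.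
rewrite [prodV v i n _]prodV_step // prodV_mv ?ltnn //.
congr (lam (outer_modes _ _ (Y (mosva_Y _ _ _) _ _))).
  by rewrite /mv eqxx; lia.
by rewrite (parsum_step lin) /mv eqxx [n == i]eq_sym (negbTE ni); lia.
Qed.

Lemma stage_core L (s : seq (C * (nat -> int))) :
  mul_diffs L (stage n) = laurent_coef n.+1 s ->
  mul_diffs_at 0 n L (stage 0) = laurent_coef_at (fun j => half (par j)) 0 n s.
Proof.
move=> H; apply: (stages_transfer (par := par) (c := stage)).
- by move=> i _; rewrite -half_addz (_ : _ + _ = 2 * (par i)%:Z) ?half_double //; ring.
- exact: stage_trans.
- exact: stage_bounded_below.
- by rewrite mul_diffs_at_n laurent_coef_at_n.
Qed.

Lemma mul_diffs_setn L (c1 c2 : (nat -> int) -> C) (b : int) e :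
  all (fun ab => (ab.1 < ab.2 < n)%N) L ->
  (forall e, c1 e = c2 (mv e n (b - e n))) ->
  mul_diffs L c1 e = mul_diffs L c2 (mv e n (b - e n)).
Proof.
move=> hL H; elim: L e hL => //= -[x y] L IH e /andP[/= /andP[xy yn] hL].
have E k : (k < n)%N -> mul_diffs L c1 (mv e k (-1)) = mul_diffs L c2 (mv (mv e n (b - e n)) k (-1)).
  by move=> kn; rewrite IH // mvC mvN // gtn_eqF.
by rewrite /mulX !E // (ltn_trans xy).
Qed.

Lemma iterate_step L (s : seq (C * (nat -> int))) z b : iterates_converge n ->
  all (fun ab => (ab.1 < ab.2 <= n)%N) L ->
  mul_diffs L (stage n) = laurent_coef n.+1 s -> nested n.+1 z ->
  nat_iter_sums n (fun N => lam (Y (iterV v N n) (- 2 * b - 2 - parsum 0) w) *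
                    \prod_(i < n) xd n.+1 z i ^ (- N i - 1))
    (laurent_val n (innermono (fun j => half (par j)) n L s b) (fun j => z j - z n) /
     diffs_val (inner n L) (fun j => z j - z n)).
Proof.
move=> IH hL /stage_core H /nested_sub Hr.
(* Taking the coefficient of one power of [z_n] gives a linear functional of the inner iterate, to
   which the induction hypothesis applies. *)
pose lamb y := lam (Y y (- 2 * b - 2 - parsum 0) w).
have lambl : linear (lamb : V -> C^o) by move=> a x y; rewrite /lamb Yl laml.
have hL' : all (fun ab => (ab.1 < ab.2 < n)%N) (inner n L).
  apply/allP => ab; rewrite mem_filter => /andP[bn /(allP hL) /andP[-> h]] /=.
  by rewrite ltn_neqAle bn h.
have := IH v lamb (inner n L) (innermono (fun j => half (par j)) n L s b) _ lambl hL' _ Hr.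
move=> /(_ _) T; have {}T := T _.
apply: eq_nat_iter_sums (T _) => [N|].
  by congr (_ * _); apply: eq_bigr => i _; rewrite xd_sub.
apply/funext => e.
rewrite (@mul_diffs_setn _ _ (stage 0) b) //; last first.
  move=> e'; rewrite /stage /lamb prodV_mv ?ltnn ?andbF // mvii.
  by congr (lam (Y _ _ _)); lia.
rewrite -mul_diffs_at0 // H laurent_coef_at0_innermono // mvii (_ : e n + (b - e n) = b); last by ring.
apply: eq_bigr => t _; congr (_ * _); apply: eq_bigr => j _; rewrite mvN //.
by rewrite ltn_eqF.
Qed.

End Step.

(** Here [V] acts on itself: [v n.+1] takes the place of [w], and all parities are 0, so no branch
    has to be chosen. *)
Lemma mosva_iterates_converge n : iterates_converge n.
Proof.
elim: n => [|n IH] v lam L s u laml hL HD Hr.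
  case: L hL HD => [_ HD|[a b] L]; last by rewrite /= ltn0 andbF.
  rewrite /= big_ord0 mulr1 /diffs_val big_nil divr1.
  have := congr1 (@^~ (fun=> 0)) HD; rewrite /= => ->.
  by apply: eq_bigr => t _; rewrite !big_ord0.
have Y2l m x : linear (fun y : V => mosva_Y2 y m x) by move=> a y y'; exact: mosva_Y_linear.
have Y2r y m : linear (@mosva_Y2 R V y m) by move=> a x x'; rewrite /mosva_Y2 linearP.
have wa i : (i < n)%N -> weak_assoc (@mosva_Y2 R V) 0 (v i) (v n.+1) by move=> _; exact: mosva_weak_assoc.
have hL' : all (fun ab => (ab.1 < ab.2 <= n)%N) L by [].
have ps : parsum (fun=> 0%N) n 0 = 0 by rewrite /parsum big1.
have st : (fun e => lam (prodV v 0 n.+1 e)) = stage (@mosva_Y2 R V) (fun=> 0%N) v (v n.+1) lam n n.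
  apply/funext => e; rewrite /stage -outer_last; congr (lam _).
  rewrite /outer_modes /prodV subn0; elim: (iota 0 n.+1) => //= j l ->.
  by rewrite /mosva_Y2; congr (mosva_Y _ _ _); lia.
rewrite st in HD; have [u0 hu] := nested_last Hr.
have T b := @iterate_step V (@mosva_Y2 R V) Y2l Y2r (fun=> 0%N) v (v n.+1) lam n laml wa L s u b IH hL' HD Hr.
have := asum_innermono (hh := fun=> 0) (sg := fun=> 1) s u0 hL' hu _.
rewrite big1 // mul1r => A.
pose val b := laurent_val n (innermono (fun=> 0) n L s b) (fun j => u j - u n) /
  diffs_val (inner n L) (fun j => u j - u n).
(* Mode [m] of the outer operator goes with [u n ^ (- m - 1)], hence with the coefficient
   [b = - m - 1]. *)
exists (fun m => val (- m - 1) * u n ^ (- m - 1)); split.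
  move=> m; rewrite [X in nat_iter_sums _ _ X]mulrC.
  have := nat_iter_sumsZ (u n ^ (- m - 1)) (T (- m - 1)); rewrite ps.
  rewrite (_ : innermono (fun j => Defs.half R 0%N) n L s (- m - 1) = innermono (fun=> 0) n L s (- m - 1)); last first.
    by congr innermono; apply/funext => j; rewrite /Defs.half mul0r.
  apply: eq_nat_iter_sums => N; rewrite /= iterV_upd // big_ord_recr /= (_ : xd n.+1 u n = u n) /upd ?eqxx; last by rewrite /xd ltnn.
  rewrite /mosva_Y2 (_ : (_ %/ 2)%Z = m); last by lia.
  rewrite mulrCA [u n ^ _ * _]mulrC; congr (_ * (_ * _)).
  by apply: eq_bigr => i _; rewrite ltn_eqF.
apply/(asum_reindex (f := fun b : int => - b - 1) (g := fun m : int => - m - 1)).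
- by move=> b; lia.
- by move=> m /eqP; lia.
- apply: eq_asum (A _) => [b|j jn] /=.
    by rewrite (_ : - (- b - 1) - 1 = b) //; ring.
  have := binom_sums_nat 0 ((u j - u n) / u n); rewrite expr0.
  by [].
Qed.

End Iterates.

(** * From products to formal identities *)

Section FiniteVariables.
Variable R : realType.
Local Notation C := R[i].

Definition nat_ext d (N : {ffun 'I_d -> int}) : nat -> int :=
  fun i => if insub i is Some j then N j else 0.

Lemma nat_extE d (N : {ffun 'I_d -> int}) (i : 'I_d) : nat_ext N i = N i.
Proof. by rewrite /nat_ext valK. Qed.

Lemma nat_ext_out d (N : {ffun 'I_d -> int}) i : (d <= i)%N -> nat_ext N i = 0.
Proof. by move=> di; rewrite /nat_ext insubF // ltnNge di. Qed.

Lemma nat_ext_ext_index d (N : {ffun 'I_d -> int}) m : nat_ext (ext_index N m) = upd (nat_ext N) d m.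
Proof.
apply/funext => i; rewrite /upd; case: (ltngtP i d) => [id|di|->].
- have id' := ltnW id; rewrite -ltnS in id'.
  rewrite (nat_extE (ext_index N m) (Ordinal id')) ffunE.
  have -> : Ordinal id' = lift ord_max (Ordinal id) by apply/val_inj; rewrite /= /bump leqNgt id.
  by rewrite liftK (nat_extE N (Ordinal id)).
- by rewrite !nat_ext_out // ltnW.
- have := nat_extE (ext_index N m) ord_max; rewrite ffunE unlift_none; apply.
Qed.

Lemma nat_iter_sums_ext d (a : (nat -> int) -> C) s : nat_iter_sums d a s ->
  iter_abs_sums_to (fun N : {ffun 'I_d -> int} => a (nat_ext N)) s.
Proof.
elim: d a s => [|d IH] a s /=.
  by move=> <-; congr a; apply/funext => i; rewrite nat_ext_out.
move=> [b [Hb Hs]]; exists b; split; last exact/abs_sums_toP.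
move=> m; have := IH _ _ (Hb m); congr iter_abs_sums_to.
by apply/funext => N; rewrite nat_ext_ext_index.
Qed.

Variable n : nat.
Implicit Types (c : (nat -> int) -> C) (z : nat -> C).

Definition laurent_sums c z s :=
  asum (fun e : {ffun 'I_n.+1 -> int} => c (nat_ext e) * \prod_(i < n.+1) z i ^ e i) s.

Lemma laurent_sums_mulX c z s k : z k != 0 -> (k < n.+1)%N -> laurent_sums c z s -> laurent_sums (mulX k c) z (z k * s).
Proof.
move=> zk kn H; rewrite /laurent_sums.
pose f (d : int) (e : {ffun 'I_n.+1 -> int}) : {ffun 'I_n.+1 -> int} :=
  [ffun i => e i + (if i == k :> nat then d else 0)].
have fK d : cancel (f d) (f (- d)).
  by move=> e; apply/ffunP => i; rewrite !ffunE; case: eqP => _; rewrite ?addr0 // addrK.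
apply/(asum_reindex (f := f 1) (g := f (-1))) => //.
  by move=> e; rewrite -{1}[1](opprK 1) fK eqxx.
apply: eq_asum (asumZ (z k) H) => e /=; rewrite mulrCA; congr (_ * _).
  rewrite /mulX; congr c; apply/funext => i; rewrite /mv; case: (ltnP i n.+1) => hi.
    rewrite (nat_extE e (Ordinal hi)) (nat_extE (f 1 e) (Ordinal hi)) !ffunE /=; case: eqP => _; by rewrite ?addr0 // addrK.
  by rewrite !nat_ext_out // gtn_eqF ?addr0 // (leq_trans kn).
rewrite (bigD1 (Ordinal kn)) //= [RHS](bigD1 (Ordinal kn)) //= !ffunE eqxx expfzDr // expr1z.
rewrite [in RHS](eq_bigr (fun i : 'I_n.+1 => z i ^ e i)); first by ring.
move=> i ik; rewrite ffunE (_ : (i == k :> nat) = false) ?addr0 //.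
by apply: contraNF ik => /eqP h; apply/eqP/val_inj.
Qed.

Lemma laurent_sums_mul_diffs L c z s : (forall i, (i < n.+1)%N -> z i != 0) ->
  all (fun ab => (ab.1 < ab.2 < n.+1)%N) L ->
  laurent_sums c z s -> laurent_sums (mul_diffs L c) z (diffs_val L z * s).
Proof.
move=> z0; elim: L => [|[x y] L IH] /= hL H; first by rewrite /diffs_val big_nil mul1r.
move/andP: hL => [/andP[xy yn] hL]; have {}IH := IH hL H.
have xn := ltn_trans xy yn.
rewrite /diffs_val big_cons -mulrA mulrBl.
apply: eq_asum (asumB (laurent_sums_mulX (z0 _ xn) xn IH) (laurent_sums_mulX (z0 _ yn) yn IH)) => e.
by rewrite -mulrBl.
Qed.

Lemma laurent_sums_laurent_coef (s : seq (C * (nat -> int))) z : laurent_sums (laurent_coef n.+1 s) z (laurent_val n.+1 s z).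
Proof.
have H (t : C * (nat -> int)) : asum (fun e : {ffun 'I_n.+1 -> int} =>
   t.1 * \prod_(j < n.+1) (nat_ext e j == t.2 j)%:R * \prod_(i < n.+1) z i ^ e i)
   (t.1 * \prod_(j < n.+1) z j ^ t.2 j).
  pose e0 : {ffun 'I_n.+1 -> int} := [ffun i : 'I_n.+1 => t.2 i].
  have := asum_fin (t0 := [:: e0]) (a := fun e : {ffun 'I_n.+1 -> int} =>
   t.1 * \prod_(j < n.+1) (nat_ext e j == t.2 j)%:R * \prod_(i < n.+1) z i ^ e i) isT.
  rewrite big_seq1 big1 => [|j _]; last by rewrite nat_extE ffunE eqxx.
  rewrite mulr1 (eq_bigr (fun j : 'I_n.+1 => z j ^ t.2 j)) => [|j _]; last by rewrite ffunE.
  apply => e; rewrite inE => ne.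
  have [i hi] : exists i, e i != t.2 i.
    apply/existsP; apply: contraNT ne; rewrite negb_exists => /forallP h.
    by apply/eqP/ffunP => i; rewrite ffunE; apply/eqP; have := h i; rewrite negbK.
  by rewrite (bigD1 i) //= nat_extE (negbTE hi) mul0r mulr0 mul0r.
apply: eq_asum (asum_sum s H) => e; rewrite /laurent_coef mulr_suml.
by apply: eq_bigr.
Qed.

(** Coefficient families take an exponent for every [i : nat], whereas convergence only sees the
    first [n.+1] of them. *)
Definition depn c := forall e e', (forall i, (i < n.+1)%N -> e i = e' i) -> c e = c e'.

Lemma depn_mul_diffs L c : depn c -> depn (mul_diffs L c).
Proof.
move=> H; elim: L => //= ab L IH e e' ee; rewrite /mulX.
by congr (_ - _); apply: IH => i hi; rewrite /mv ee.
Qed.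

Lemma depn_laurent_coef (s : seq (C * (nat -> int))) : depn (laurent_coef n.+1 s).
Proof.
move=> e e' ee; apply: eq_bigr => t _; congr (_ * _).
by apply: eq_bigr => j _; rewrite ee.
Qed.

Lemma depn_ext c1 c2 : depn c1 -> depn c2 ->
  (forall e : {ffun 'I_n.+1 -> int}, c1 (nat_ext e) = c2 (nat_ext e)) -> c1 = c2.
Proof.
move=> H1 H2 H; apply/funext => e; pose e' : {ffun 'I_n.+1 -> int} := [ffun i : 'I_n.+1 => e i].
have E i : (i < n.+1)%N -> e i = nat_ext e' i.
  by move=> hi; rewrite (nat_extE e' (Ordinal hi)) ffunE.
by rewrite (H1 _ _ E) H (H2 _ _ E).
Qed.

Lemma laurent_coef_unique L (s : seq (C * (nat -> int))) c : depn c ->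
  all (fun ab => (ab.1 < ab.2 < n.+1)%N) L ->
  (forall z : 'I_n.+1 -> C, product_region z ->
     laurent_sums c (fun i => z (inord i)) (laurent_val n.+1 s (fun i => z (inord i)) / diffs_val L (fun i => z (inord i)))) ->
  mul_diffs L c = laurent_coef n.+1 s.
Proof.
move=> dc hL H; apply: depn_ext; [exact: depn_mul_diffs|exact: depn_laurent_coef|] => e.
apply/eqP; rewrite -subr_eq0; apply/eqP.
(* The radii [n + 1, n, ..., 1] place the whole torus in the product region. *)
pose r (i : 'I_n.+1) : R := (n.+1 - i)%N%:R.
have r0 i : 0 < r i by rewrite ltr0n subn_gt0.
apply: (torus_coef_eq0 (r := r) (c := fun e => mul_diffs L c (nat_ext e) - laurent_coef n.+1 s (nat_ext e))) => //.
move=> z hz; have zpr : product_region z.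
  split=> [i j ij|i]; rewrite !hz // ltr_nat.
  by rewrite ltn_sub2l.
have z0 i : (i < n.+1)%N -> z (inord i) != 0 by rewrite -cabs_gt0 hz.
have D0 : diffs_val L (fun i => z (inord i)) != 0.
  rewrite /diffs_val prodf_seq_neq0; apply/allP => ab /(allP hL) /andP[h1 h2] /=.
  rewrite subr_eq0; apply/eqP => /(congr1 (@cabs R)); rewrite !hz => /eqP.
  rewrite /r eqr_nat !inordK ?(ltn_trans h1) //; lia.
have := laurent_sums_mul_diffs z0 hL (H z zpr); rewrite mulrCA divff // mulr1 => h.
have := asumB h (laurent_sums_laurent_coef s (fun i => z (inord i))); rewrite subrr.
apply: eq_asum => e'; rewrite -mulrBl; congr (_ * _).
by apply: eq_bigr => i _; rewrite inord_val.
Qed.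

End FiniteVariables.

Section Encoding.
Variables (R : realType) (n : nat).
Local Notation C := R[i].
Implicit Types (z : 'I_n.+1 -> C).

Definition nat_points z : nat -> C := fun i => z (inord i).

Definition pairs (qq : 'I_n.+1 -> 'I_n.+1 -> nat) : seq (nat * nat) :=
  flatten [seq flatten [seq nseq (qq i j) (val i, val j) | j : 'I_n.+1 <- enum 'I_n.+1 & (i < j)%N]
          | i : 'I_n.+1 <- enum 'I_n.+1].

Lemma pairs_lt qq : all (fun ab => (ab.1 < ab.2 < n.+1)%N) (pairs qq).
Proof.
apply/allP => ab /flattenP[_ /mapP[i _ ->] /flattenP[_ /mapP[j hj ->] /nseqP[-> _]]] /=.
by move: hj; rewrite mem_filter ltn_ord andbT => /andP[].
Qed.

Lemma diffs_val_pairs qq z : diffs_val (pairs qq) (nat_points z) =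
  \prod_(i < n.+1) \prod_(j < n.+1 | (i < j)%N) (z i - z j) ^+ qq i j.
Proof.
rewrite /diffs_val big_flatten big_map big_enum /=; apply: eq_bigr => i _.
rewrite big_flatten big_map big_filter big_enum_cond /=; apply: eq_bigr => j _.
by rewrite big_nseq /nat_points /= !inord_val -Monoid.iteropE.
Qed.

Definition monos (g : mpoly.mpoly n.+1 C) (q : 'I_n.+1 -> nat) : seq (C * (nat -> int)) :=
  [seq (mpoly.mcoeff m g, fun j : nat => (mpoly.fun_of_multinom m (inord j))%:Z - (q (inord j))%:Z)
  | m <- mpoly.msupp g].

Lemma laurent_val_monos g q z : (forall i, z i != 0) ->
  laurent_val n.+1 (monos g q) (nat_points z) = mpoly.meval z g / \prod_(i < n.+1) z i ^+ q i.
Proof.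
move=> z0; rewrite /laurent_val big_map mpoly.mevalE mulr_suml; apply: eq_bigr => m _ /=.
rewrite -mulrA; congr (_ * _); rewrite -prodfV -big_split /=; apply: eq_bigr => i _.
by rewrite /nat_points inord_val expfzDr // -!exprnP -invr_expz -exprnP.
Qed.

Lemma nested_iterate_region z : iterate_region z -> nested n.+1 (nat_points z).
Proof.
move=> [z0 h1 h2].
have zn : nat_points z n = z ord_max by congr z; apply/val_inj; rewrite /= inordK.
split=> [i j|_] /=; last by rewrite zn.
rewrite ltnS [(i <= n)%N]leq_eqVlt => /andP[ji /orP[/eqP ei|lin]].
  subst i; have [] := h1 (Ordinal ji).
  have -> : zlo z (Ordinal ji) = nat_points z j by congr z; apply/val_inj; rewrite /= inordK // ltnS ltnW.
  by rewrite -zn /xd ltnn => ? ? _.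
have := h2 (Ordinal (ltn_trans ji lin)) (Ordinal lin) ji.
have -> : zlo z (Ordinal lin) = nat_points z i by congr z; apply/val_inj; rewrite /= inordK // ltnS ltnW.
have -> : zhi z (Ordinal lin) = nat_points z i.+1 by congr z; apply/val_inj; rewrite /= /bump /= add1n inordK.
have -> : zlo z (Ordinal (ltn_trans ji lin)) = nat_points z j.
  by congr z; apply/val_inj; rewrite /= inordK // ltnS ltnW // (ltn_trans ji).
by rewrite /xd ltnS lin.
Qed.

End Encoding.

(** * Correlation functions of a twisted module *)

Section Assembly.
Variables (R : realType) (V : mosva R) (theta : involution V) (W : twisted_module theta).
Variables (n : nat) (v : 'I_n.+1 -> V) (k : 'I_n.+1 -> int).
Hypothesis hv : forall i, mosva_gr (k i) (v i).
Variables (w : W) (w' : restricted_dual W).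
Local Notation C := R[i].
Local Notation half := (Defs.half R).

Definition nat_vecs i := v (inord i).
Definition nat_par i := par (k (inord i)).

Lemma rdual_linear : linear ((w' : W -> C) : W -> C^o).
Proof. by move=> a x y; rewrite linearP. Qed.

Lemma tw_Y_linear_r u m : linear (tw_Y W u m : W -> W).
Proof. by move=> a x y; rewrite linearP. Qed.

Definition corr (e : nat -> int) : C := w' (outer_modes (tw_Y W) nat_par nat_vecs n.+1 e w).

Lemma corr_stage : corr = stage (tw_Y W) nat_par nat_vecs w w' n n.
Proof. by apply/funext => e; rewrite /corr outer_last. Qed.

Lemma product_termE p (z : 'I_n.+1 -> C) (e : {ffun 'I_n.+1 -> int}) : (forall i, z i != 0) ->
  product_term v w w' p z [ffun i => - 2 * e i - 2 - (par (k i))%:Z] =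
  corr (nat_ext e) * \prod_(i < n.+1) z i ^ e i *
  \prod_(i < n.+1) cexp (half (par (k i)) * clog p (z i)).
Proof.
move=> z0; rewrite /product_term -mulrA -big_split /=; congr (w' _ * _).
  rewrite /outer_modes -(val_enum_ord n.+1); elim: (enum _) => //= i l ->.
  by rewrite ffunE nat_extE /nat_vecs /nat_par inord_val.
apply: eq_bigr => i _; rewrite ffunE.
have -> : z i ^ e i = cexp ((e i)%:~R * clog p (z i)) by rewrite cexp_int cexp_clog.
rewrite -cexpD; congr cexp.
by rewrite -mulrDl -half_double -half_addz; congr (half _ * _); ring.
Qed.

Lemma product_term_eq0 p (z : 'I_n.+1 -> C) (N : {ffun 'I_n.+1 -> int}) : (exists i, odd (absz (N i - (par (k i))%:Z))) ->
  product_term v w w' p z N = 0.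
Proof.
move=> [i oi]; rewrite /product_term (_ : foldr _ _ _ = 0) ?raddf0 ?mul0r //.
have : i \in enum 'I_n.+1 by rewrite mem_enum.
elim: (enum _) => //= j l IH; rewrite inE => /orP[/eqP <-|/IH ->]; last by rewrite raddf0.
exact: tw_parity (hv i) oi.
Qed.

(** Terms of the wrong parity vanish, and in the others the half powers form the common factor [X];
    dividing by it leaves an ordinary Laurent series, independent of the branch. *)
Lemma corr_fsum p (z : 'I_n.+1 -> C) (s : C) : product_region z ->
  abs_sums_to (product_term v w w' p z)
    ((\prod_(i < n.+1) cexp (half (par (k i)) * clog p (z i))) * s) ->
  laurent_sums n corr (nat_points z) s.
Proof.
move=> [_ hz] /abs_sums_toP H; have z0 i : z i != 0 by rewrite -cabs_gt0.
set X := \prod_(i < n.+1) cexp _ in H.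
have X0 : X != 0 by apply/prodf_neq0 => i _; exact: cexp_neq0.
pose f (e : {ffun 'I_n.+1 -> int}) : {ffun 'I_n.+1 -> int} :=
  [ffun i => - 2 * e i - 2 - (par (k i))%:Z].
pose h (N : {ffun 'I_n.+1 -> int}) : {ffun 'I_n.+1 -> int} :=
  [ffun i => ((- N i - 2 - (par (k i))%:Z) %/ 2)%Z].
have : asum (product_term v w w' p z \o f) (X * s).
  apply/(asum_reindex (g := h)) => //.
    move=> e; apply/ffunP => i; rewrite !ffunE.
    by move: (e i : int) (par (k i)) => x y; rewrite (_ : _ - _ - _ = x * 2) ?mulzK //; ring.
  move=> N ne; apply: product_term_eq0; apply/existsP; apply: contraNT ne.
  rewrite negb_exists => /forallP hh; apply/eqP/ffunP => i; rewrite !ffunE.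
  by have := hh i; move: (N i : int) (par (k i)) => x y; lia.
move/(asumZ X^-1); rewrite mulKf //; apply: eq_asum => e /=.
rewrite product_termE // mulrC mulrK ?unitfE //; congr (_ * _).
by apply: eq_bigr => i _; rewrite /nat_points inord_val.
Qed.

Lemma depn_corr : depn n corr.
Proof.
move=> e e' ee; rewrite /corr /outer_modes; congr (w' _).
have : all (fun j => (j < n.+1)%N) (iota 0 n.+1) by apply/allP => j; rewrite mem_iota.
by elim: (iota 0 n.+1) => //= j l IH /andP[/ee -> /IH ->].
Qed.

Lemma iterate_vecE (N : {ffun 'I_n.+1 -> int}) : iterate_vec v N = iterV nat_vecs (nat_ext N) n.
Proof.
rewrite /iterate_vec.
have -> : v ord0 = nat_vecs 0 by congr v; apply/val_inj; rewrite /= inordK.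
pose G u i := mosva_Y u (nat_ext N i) (nat_vecs i.+1).
transitivity (foldl G (nat_vecs 0) (iota 0 n)).
  rewrite -(val_enum_ord n); elim: (enum _) (nat_vecs 0) => //= i l IH u; rewrite IH; congr foldl.
  rewrite /G -(nat_extE N) /=; congr (mosva_Y _ _ (v _)).
  by apply/val_inj; rewrite /= /bump /= add1n inordK // ltnS.
have key m : foldl G (nat_vecs 0) (iota 0 m) = iterV nat_vecs (nat_ext N) m.
  by elim: m => // m IH; rewrite -(addn1 m) iotaD foldl_cat IH addn1.
exact: key.
Qed.

(** A mode of [V] shifts weights by an integer, so the parity of the iterate is the sum of the
    parities modulo 2. With [tw_parity], this decides which outer modes vanish. *)
Lemma iterV_gr N m : exists k', mosva_gr k' (iterV nat_vecs N m) /\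
  ~~ odd (absz (k' - \sum_(0 <= j < m.+1) (nat_par j)%:Z)%R).
Proof.
elim: m => [|m [k' [gk ok]]] /=.
  exists (k (inord 0)); split; first exact: hv.
  by rewrite big_nat1 /nat_par /par; lia.
exists (k' + k (inord m.+1) - 2 * N m - 2); split.
  exact: mosva_Y_gr.
rewrite big_nat_recr //= {2}/nat_par /par.
by move: ok; set S := \sum_(0 <= j < m.+1) _; lia.
Qed.

End Assembly.

Theorem proposition2p9 (R : realType) (V : mosva R) (theta : involution V)
    (W : twisted_module theta) (n : nat)
    (v : 'I_n.+1 -> V) (k : 'I_n.+1 -> int)
    (hv : forall i, mosva_gr (k i) (v i))
    (w : W) (w' : restricted_dual W)
    (g : mpoly.mpoly n.+1 R[i]) (q : 'I_n.+1 -> nat)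
    (qq : 'I_n.+1 -> 'I_n.+1 -> nat)
    (hf : forall (p : int) (z : 'I_n.+1 -> R[i]), product_region z ->
       abs_sums_to (product_term v w w' p z) (branch k g q qq p z)) :
  forall (p : int) (z : 'I_n.+1 -> R[i]), iterate_region z ->
    iter_abs_sums_to (iterate_term v w w' p z) (branch k g q qq p z).
Proof.
move=> p z hz.
have Hr := nested_iterate_region hz; have [zn0 hu] := nested_last Hr.
have nat_pointsE (i : 'I_n.+1) : nat_points z i = z i by rewrite /nat_points inord_val.
have nat_pointsn : nat_points z n = z ord_max by rewrite -nat_pointsE.
have z0 i : z i != 0.
  rewrite -nat_pointsE; case: (ltngtP i n) => [/hu[h _]|ni|->] //; last first.
    by move: (ltn_ord i); rewrite ltnS leqNgt ni.
  by apply: contraTneq h => ->; rewrite sub0r cabsN ltxx.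
pose s := monos g q; pose L := pairs qq.
have hL : all (fun ab => (ab.1 < ab.2 <= n)%N) L := pairs_lt qq.
have HD : mul_diffs L (stage (tw_Y W) (nat_par k) (nat_vecs v) w w' n n) = laurent_coef n.+1 s.
  rewrite -corr_stage; apply: (laurent_coef_unique (depn_corr _ _ _ _) (pairs_lt qq)) => z1 hz1.
  have z10 i : z1 i != 0 by rewrite -cabs_gt0; case: hz1 => _.
  (* The coefficients do not depend on the branch, so one value of [p] is enough to identify
     them. *)
  apply: (corr_fsum hv (p := 0) hz1).
  have := hf 0 z1 hz1; rewrite /branch.
  by rewrite (laurent_val_monos g q z10) diffs_val_pairs -mulrA -invfM.
pose l := clog p (z ord_max); pose hh j := Defs.half R (nat_par k j).
pose sig := parsum (nat_par k) n 0.
pose val b := laurent_val n (innermono hh n L s b) (fun j => nat_points z j - nat_points z n) /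
  diffs_val (inner n L) (fun j => nat_points z j - nat_points z n).
pose a N := w' (tw_Y W (iterV (nat_vecs v) N n) (N n) w) *
  \prod_(i < n) xd n.+1 (nat_points z) i ^ (- N i - 1) * cexp (Defs.half R (- N n - 2) * l).
suff H : nat_iter_sums n.+1 a (branch k g q qq p z).
  have := nat_iter_sums_ext H; congr iter_abs_sums_to; apply/funext => N.
  rewrite /a /iterate_term iterate_vecE (nat_extE N ord_max); congr (_ * _ * _).
  apply: eq_bigr => i _; rewrite /xd ltnS ltn_ord (nat_extE N (widen_ord (leqnSn n) i)).
  congr ((_ - _) ^ _); first by rewrite -[RHS]nat_pointsE.
  by rewrite -[RHS]nat_pointsE /= /bump /= add1n.
have wa i : (i < n)%N -> weak_assoc (tw_Y W) (nat_par k i) (nat_vecs v i) w.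
  by move=> _; apply: tw_weak_assoc (hv _).
have Tb b := @iterate_step R V W (tw_Y W) (@tw_Y_linear _ _ _ W) (@tw_Y_linear_r _ _ _ W)
  (nat_par k) (nat_vecs v) w w' n (rdual_linear w') wa L s (nat_points z) b (@mosva_iterates_converge _ V n) hL HD Hr.
(* The sum of the inner iterate at outer mode [m]. The exponent [- m / 2 - 1] equals [b + sig / 2]
   for an integer [b] only if [m] and [sig] have the same parity. *)
pose B m := if odd (absz (m - sig)%R) then 0 else
  cexp (Defs.half R (- m - 2) * l) * val ((- m - 2 - sig) %/ 2)%Z.
exists B; split.
  move=> m; rewrite /B; case: ifPn => om.
    apply: eq_nat_iter_sums (nat_iter_sums0 R n) => N; rewrite /a iterV_upd // /upd eqxx.
    have [k' [gk ok]] := iterV_gr hv N n.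
    rewrite (tw_parity (k := k')) ?raddf0 ?mul0r //.
    move: om ok; rewrite /sig /parsum; set S := \sum_(0 <= j < n.+1) _.
    by rewrite /par; lia.
  have mE : m = - 2 * ((- m - 2 - sig) %/ 2)%Z - 2 - sig by lia.
  have := nat_iter_sumsZ (cexp (Defs.half R (- m - 2) * l)) (Tb ((- m - 2 - sig) %/ 2)%Z).
  apply: eq_nat_iter_sums => N; rewrite /a iterV_upd // /upd eqxx -/sig -mE mulrC; congr (_ * _ * _).
  by apply: eq_bigr => i _; rewrite ltn_eqF.
(* The value of [(z_j / z_n)^(hh j)] given by the branch [p]; the condition on arguments makes it
   the sum of the binomial series. *)
pose sg j := cexp (hh j * (clog p (nat_points z j) - clog p (nat_points z n))).
have hsg j : (j < n)%N -> binom_sums (hh j) ((nat_points z j - nat_points z n) / nat_points z n) (sg j).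
  move=> jn; rewrite /sg /hh /nat_par; case: (par (k (inord j))) (par_lt2 (k (inord j))) => [|[|//]] _.
    have := binom_sums_nat 0 ((nat_points z j - nat_points z n) / nat_points z n).
    by rewrite /Defs.half !mul0r cexp0 expr0.
  apply: binom_sums_half_clog; [exact: zn0|by have [] := hu j jn|].
  have [_ h1 _] := hz; have [_ _] := h1 (Ordinal jn).
  have -> : zlo z (Ordinal jn) = nat_points z j by rewrite -[LHS]nat_pointsE.
  by rewrite nat_pointsn.
have := asumZ (cexp (Defs.half R sig * l)) (asum_innermono s zn0 hL hu hsg).
have -> : cexp (Defs.half R sig * l) *
    (\prod_(j < n) sg j * (laurent_val n.+1 s (nat_points z) / diffs_val L (nat_points z))) = branch k g q qq p z.
  rewrite /branch (laurent_val_monos g q z0) diffs_val_pairs mulrA; congr (_ * _); last by rewrite invfM mulrA.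
  (* [z_n ^ (sig / 2)] supplies a power [hh j] of [z_n] for each point, turning [sg j] into the
     branch of [z_j ^ (hh j)] and leaving the one of [z_n] itself. *)
  have -> : cexp (Defs.half R sig * l) = \prod_(j < n.+1) cexp (hh j * l).
    rewrite /sig /parsum big_mkord; elim/big_rec2: _ => [|j x y _ IH].
      by rewrite /Defs.half mul0r mul0r cexp0.
    by rewrite half_addz mulrDl cexpD IH.
  rewrite !big_ord_recr /= mulrAC; congr (_ * _).
    rewrite -big_split /=; apply: eq_bigr => j _.
    rewrite /sg -cexpD -mulrDr /l -nat_pointsn addrC subrK /hh /nat_par.
    have <- : inord j = widen_ord (leqnSn n) j by apply/val_inj; rewrite /= inordK // ltnS ltnW.
    by [].
  have -> : ord_max = inord n :> 'I_n.+1 by apply/val_inj; rewrite /= inordK.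
  by rewrite /hh /nat_par /l -nat_pointsn.
move=> H; apply/(asum_reindex (f := fun b : int => - 2 * b - 2 - sig)
  (g := fun m => ((- m - 2 - sig) %/ 2)%Z)).
- by move=> b; rewrite (_ : _ - _ - _ = b * 2) ?mulzK //; ring.
- by move=> m /eqP hm; rewrite /B ifT //; lia.
apply: eq_asum H => b /=; rewrite /B ifF; last by apply/negbTE; lia.
rewrite (_ : (_ %/ 2)%Z = b); last by rewrite (_ : _ - _ - _ = b * 2) ?mulzK //; ring.
rewrite mulrCA [RHS]mulrC -/(val b); congr (_ * _).
have -> : nat_points z n ^ b = cexp (b%:~R * l) by rewrite cexp_int cexp_clog // nat_pointsn.
rewrite -cexpD; congr cexp.
by rewrite -mulrDl -half_double -half_addz; congr (Defs.half R _ * _); ring.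
Qed.
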